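(* Let $n\ge2$ and let $B$ be a translation invariant convex density basis in $\mathbb{R}^n$. Then its Busemann-Feller extension $B_{\mathrm{BF}}$ is also a density basis, and $B$ and $B_{\mathrm{BF}}$ locally majorize each other (i.e. $B\le B_{\mathrm{BF}}$ and $B_{\mathrm{BF}}\le B$).
   Context: $L(\mathbb{R}^n)$ is the class of Lebesgue integrable functions on $\mathbb{R}^n$; $|E|$ is Lebesgue measure. A differentiation basis (basis) $B$ in $\mathbb{R}^n$ is a mapping assigning to each $x\in\mathbb{R}^n$ a family $B(x)$ of bounded measurable sets of positive measure containing $x$, such that there is a sequence $(R_k)$ in $B(x)$ with $\operatorname{diam}R_k\to 0$. For $f\in L(\mathbb{R}^n)$, $\overline{D}_B(\int f,x)$ and $\underline{D}_B(\int f,x)$ denote the upper and lower limits of $\frac{1}{|R|}\int_R f$ over $R\in B(x)$ as $\operatorname{diam}R\to 0$. $B$ differentiates $\int f$ if $\overline{D}_B(\int f,x)=\underline{D}_B(\int f,x)=f(x)$ for almost all $x$. $B$ is translation invariant if $R\in B(x)$ implies $T(R)\in B(T(x))$ for every translation $T$ of $\mathbb{R}^n$; convex if all sets in all $B(x)$ are convex; a density basis if $B$ differentiates $\int\chi_E$ for every bounded measurable set $E\subset\mathbb{R}^n$. The spread of $B$ is $\overline{B}=\bigcup_{x\in\mathbb{R}^n}B(x)$, and the Busemann-Feller extension of $B$ is the basis $B_{\mathrm{BF}}(x)=\{R\in\overline{B}: x\in R\}$. For $r\in(0,\infty]$ and $f\in L_{\mathrm{loc}}(\mathbb{R}^n)$,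 $M_B^r(f)(x)=\sup_{R\in B(x),\,\operatorname{diam}R<r}\frac{1}{|R|}\int_R|f|$. $B$ is measurable if for every $f\in L(\mathbb{R}^n)$ the functions $\overline{D}_B(\int f,\cdot)$, $\underline{D}_B(\int f,\cdot)$ and $M_B^r(f)$ ($r\in(0,\infty]$) are measurable; every translation invariant basis is measurable, and $B_{\mathrm{BF}}$ is translation invariant whenever $B$ is. For measurable bases $B,B'$: $B'$ locally majorizes $B$ (written $B\le B'$) if there exist $c\ge1$ and $\delta>0$ such that $|\{M_B^r(f)\ge\lambda\}|\le c\,|\{M_{B'}^{cr}(f)\ge\lambda/c\}|$ for every $f\in L(\mathbb{R}^n)$, $r\in(0,\delta)$ and $\lambda\in(0,\infty)$. *)

(* Defs.v *)
From HB Require Import structures.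
From mathcomp Require Import all_boot all_order all_algebra.
From mathcomp Require Import all_classical all_reals all_analysis.
From mathcomp Require Import measurable_realfun.

Set Implicit Arguments.
Unset Strict Implicit.
Unset Printing Implicit Defensive.
Import Order.TTheory GRing.Theory Num.Theory.
Import numFieldNormedType.Exports.
Local Open Scope classical_set_scope.
Local Open Scope ring_scope.

Section lebesgue_rV.
Context {R : realType} {n : nat}.
Local Open Scope ereal_scope.

Definition box (a b : 'rV[R]_n) : set 'rV[R]_n :=
  [set x | forall i, (a ord0 i <= x ord0 i <= b ord0 i)%R].

(* The maximum makes the volume of an empty box vanish. *)
Definition box_volume (a b : 'rV[R]_n) : R :=
  (\prod_(i < n) Num.max 0 (b ord0 i - a ord0 i))%R.

(* A countable family of boxes is indexed by a subset of nat, so that the empty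
   set has the empty cover, also in dimension 0 where no box is empty. *)
Definition box_cover (E : set 'rV[R]_n)
    (c : set nat * (nat -> 'rV[R]_n * 'rV[R]_n)) :=
  E `<=` \bigcup_(k in c.1) box (c.2 k).1 (c.2 k).2.

Definition cover_volume (c : set nat * (nat -> 'rV[R]_n * 'rV[R]_n)) : \bar R :=
  \esum_(k in c.1) (box_volume (c.2 k).1 (c.2 k).2)%:E.

Definition lebesgue_outer (E : set 'rV[R]_n) : \bar R :=
  ereal_inf [set cover_volume c | c in box_cover E].

Lemma box_volume_ge0 a b : 0 <= (box_volume a b)%:E.
Proof. by rewrite lee_fin prodr_ge0// => i _; rewrite le_max lexx. Qed.

Lemma cover_volume_ge0 c : 0 <= cover_volume c.
Proof. by apply: esum_ge0 => k _; exact: box_volume_ge0. Qed.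

Lemma lebesgue_outer_ge0 E : 0 <= lebesgue_outer E.
Proof. by apply: le_ereal_inf_tmp => _ [c _ <-]; exact: cover_volume_ge0. Qed.

Lemma lebesgue_outer0 : lebesgue_outer set0 = 0.
Proof.
apply/eqP; rewrite eq_le lebesgue_outer_ge0 andbT.
apply: ereal_inf_lbound; exists (set0, fun=> (0%R, 0%R)) => //.
by rewrite /cover_volume esum_set0.
Qed.

Lemma le_lebesgue_outer : {homo lebesgue_outer : A B / A `<=` B >-> A <= B}.
Proof.
move=> A B AB; apply: ereal_inf_le_tmp => _ [c cB <-].
by exists c => //; exact: subset_trans cB.
Qed.

Lemma lebesgue_outer_sigma_subadditive : sigma_subadditive lebesgue_outer.
Proof.
move=> A; have [[i ioo]|] := pselect (exists i, lebesgue_outer (A i) = +oo).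
  rewrite (eseries_pinfty _ _ ioo) ?leey// => k _.
  by rewrite -ltNye (lt_le_trans _ (lebesgue_outer_ge0 _)).
rewrite -forallNE => Aoo.
suff add2e (e : {posnum R}) :
    lebesgue_outer (\bigcup_n A n)
      <= \sum_(i <oo) lebesgue_outer (A i) + e%:num%:E.
  by apply/lee_addgt0Pr => _/posnumP[].
rewrite (le_trans _ (epsilon_trick _ _ _))//; last first.
  by move=> k; exact: lebesgue_outer_ge0.
pose P m c := box_cover (A m) c /\
  cover_volume c <= lebesgue_outer (A m) + (e%:num / (2 ^ m.+1)%:R)%:E.
have [G PG] : {G & forall m, P m (G m)}.
  apply: (@choice _ _ P) => m; rewrite /P.
  have fA : lebesgue_outer (A m) \is a fin_num.
    by rewrite ge0_fin_numE ?lebesgue_outer_ge0// ltey; exact/eqP/Aoo.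
  have en1 : (0 < e%:num / (2 ^ m.+1)%:R)%R by [].
  have [_ [c cA <-] cS] := lb_ereal_inf_adherent en1 fA.
  by exists c; split => //; exact/ltW.
pose vol p : \bar R :=
  (box_volume ((G p.1).2 p.2).1 ((G p.1).2 p.2).2)%:E.
have vol0 p : 0 <= vol p by exact: box_volume_ge0.
have /card_esym/ppcard_eqP[f] := card_nat2.
pose D : set (nat * nat) := [set p | (G p.1).1 p.2].
apply: (@le_trans _ _ (\esum_(p in D) vol p)).
  apply: ereal_inf_lbound.
  exists (f @^-1` D, fun k => (G (f k).1).2 (f k).2).
    move=> x [m _ /(PG m).1[k kG kx]].
    by exists (f^-1%FUN (m, k)); rewrite /D/= invK ?inE.
  rewrite /cover_volume (reindex_esum (f @^-1` D) D f)//.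
  split => [k //|k l _ _|p Dp].
    by move/(congr1 f^-1%FUN); rewrite !funK ?inE.
  by exists (f^-1%FUN p); rewrite /= invK ?inE.
rewrite (_ : \esum_(p in D) vol p = \sum_(m <oo) cover_volume (G m)); last first.
  rewrite nneseries_esumT; last by move=> m; exact: cover_volume_ge0.
  rewrite esum_esum//; last by move=> *; exact: box_volume_ge0.
  by congr esum; apply/seteqP; split=> p /= => [|[]].
apply: lee_nneseries => [m _ _|m _]; first exact: cover_volume_ge0.
exact: (PG m).2.
Qed.

HB.instance Definition _ := isOuterMeasure.Build R 'rV[R]_n lebesgue_outer
  lebesgue_outer0 lebesgue_outer_ge0 le_lebesgue_outer
  lebesgue_outer_sigma_subadditive.

End lebesgue_rV.

(* 'rV[R]_n with the sigma-algebra of Lebesgue (not only Borel) sets. *)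
Definition measurable_rV (R : realType) (n : nat) : Type :=
  caratheodory_type (@lebesgue_outer R n).

HB.instance Definition _ (R : realType) (n : nat) :=
  Measurable.copy (measurable_rV R n) (caratheodory_type (@lebesgue_outer R n)).

Definition lebesgue_rV {R : realType} {n : nat}
  (A : set (measurable_rV R n)) : \bar R := lebesgue_outer A.

HB.instance Definition _ (R : realType) (n : nat) :=
  isMeasure.Build _ (measurable_rV R n) R lebesgue_rV
    (caratheodory_measure0 (@lebesgue_outer R n))
    (@caratheodory_measure_ge0 _ _ (@lebesgue_outer R n))
    (@caratheodory_measure_sigma_additive _ _ (@lebesgue_outer R n)).

Section differentiation_basis.
Context {R : realType} {n : nat}.
Local Notation Rn := (measurable_rV R n).
Local Notation mu := (@lebesgue_rV R n).
Implicit Types (f : Rn -> R) (x : Rn) (S : set Rn) (r : \bar R).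
Local Open Scope ereal_scope.

(* The norm of the library on 'rV[R]_n is the sup norm. *)
Definition eucl_norm (x : 'rV[R]_n) : R :=
  Num.sqrt (\sum_(i < n) x ord0 i ^+ 2)%R.

Definition diam S : \bar R :=
  ereal_sup [set (eucl_norm ((p.1 : 'rV[R]_n) - p.2)%R)%:E | p in S `*` S].

Record diff_basis := DiffBasis {
  basis_at :> Rn -> set (set Rn) ;
  basis_atP : forall x S, basis_at x S ->
    [/\ bounded_set (S : set 'rV[R]_n), measurable S, 0 < mu S & S x] ;
  basis_at_shrink : forall x, exists2 S_ : (set Rn)^nat,
    (forall k, basis_at x (S_ k)) & diam (S_ k) @[k --> \oo] --> 0 }.

Implicit Type B : diff_basis.

Definition average f S : \bar R := (mu S)^-1 * \int[mu]_(y in S) (f y)%:E.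

Definition basis_lt B x r : set (set Rn) := [set S | B x S /\ diam S < r].

Definition upper_derivative B f x : \bar R :=
  ereal_inf [set ereal_sup [set average f S | S in basis_lt B x e%:E] |
    e in [set e : R | (0 < e)%R]].

Definition lower_derivative B f x : \bar R :=
  ereal_sup [set ereal_inf [set average f S | S in basis_lt B x e%:E] |
    e in [set e : R | (0 < e)%R]].

Definition differentiates B f :=
  {ae mu, forall x, upper_derivative B f x = (f x)%:E /\
                    lower_derivative B f x = (f x)%:E}.

Definition density_basis B := forall E : set Rn,
  measurable E -> bounded_set (E : set 'rV[R]_n) -> differentiates B \1_E.

Definition convex_basis B := forall x S,
  B x S -> convex_set (S : set (convex_lmodType 'rV[R]_n)).

Definition translation_invariant B := forall (v x : 'rV[R]_n) S,
  B x S -> B (x + v)%R [set ((y : 'rV[R]_n) + v)%R | y in S].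

Definition spread B : set (set Rn) := \bigcup_x B x.

Definition busemann_feller_at B x : set (set Rn) :=
  [set S | spread B S /\ S x].

Lemma busemann_feller_atP B x S : busemann_feller_at B x S ->
  [/\ bounded_set (S : set 'rV[R]_n), measurable S, 0 < mu S & S x].
Proof. by move=> [[y _ /basis_atP[? ? ? _]] Sx]; split. Qed.

Lemma busemann_feller_at_shrink B x : exists2 S_ : (set Rn)^nat,
  (forall k, busemann_feller_at B x (S_ k)) & diam (S_ k) @[k --> \oo] --> 0.
Proof.
have [S_ BS S0] := basis_at_shrink B x; exists S_ => // k; split.
  by exists x.
by have [] := basis_atP (BS k).
Qed.

Definition busemann_feller B : diff_basis :=
  DiffBasis (@busemann_feller_atP B) (@busemann_feller_at_shrink B).

Definition maximal B r f x : \bar R :=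
  ereal_sup [set average (fun y => `|f y|%R) S | S in basis_lt B x r].

Definition lebesgue_integrable f := mu.-integrable [set: Rn] (EFin \o f).

Definition measurable_basis B := forall f, lebesgue_integrable f ->
  [/\ measurable_fun [set: Rn] (upper_derivative B f),
      measurable_fun [set: Rn] (lower_derivative B f) &
      forall r, 0 < r -> measurable_fun [set: Rn] (maximal B r f)].

(* B <= B': the relation is defined between measurable bases only. *)
Definition locally_majorized B B' :=
  [/\ measurable_basis B, measurable_basis B' &
  exists c delta : R, [/\ (1 <= c)%R, (0 < delta)%R &
  forall f (r lambda : R), lebesgue_integrable f ->
    (0 < r < delta)%R -> (0 < lambda)%R ->
    mu [set x | lambda%:E <= maximal B r%:E f x]
      <= c%:E * mu [set x | (lambda / c)%:E <= maximal B' (c * r)%:E f x]]].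

End differentiation_basis.
Arguments diff_basis : clear implicits.

(* Main.v *)
(* Write F for the sets of B at 0; by translation invariance B is determined by F.
   1. As B is a density basis, for every lam the operator taking O to
      {x : |(x+T) /\ O| > lam |T| for some T in F of diameter < r} satisfies a weak type
      inequality |.| <= C |O| on open sets O, for some C and r: otherwise bad open sets,
      spread by translations so that their images cover half of a cube while their own
      total measure stays small, produce a set violating the density property.
      Reflecting through the origin gives the same inequality for {-T : T in F}.
   2. A convex T in F lies between X[0,1]^n and X[-2n,2n]^n for some invertible X.
      If the average of |f| over v+T exceeds lambda, a cell p+X[0,1/2]^n of v+X[-2n,2n]^n
      carries a dimensional fraction of the integral, so M_B f is at least a dimensional
      fraction of lambda on p+X[-1/2,0]^n. Applying the operators of step 1 for F and -F
      alternately, at a dimensional lam, enlarges this cell on all sides by 1/2 per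
      round, and after 8n rounds it contains v+T. Hence |{M_BF f >= lambda}| is controlled
      by |{M_B f >= lambda/c}|; the weak type inequality thus passes from B to B_BF,
      and implies that B_BF is a density basis. *)
From HB Require Import structures.
Require Import Defs.
From mathcomp Require Import all_boot all_order all_algebra.
From mathcomp Require Import all_classical all_reals all_analysis.
From mathcomp Require Import measurable_realfun.
From mathcomp Require Import perm lra ring.

Set Implicit Arguments.
Unset Strict Implicit.
Unset Printing Implicit Defensive.
Import Order.TTheory GRing.Theory Num.Theory.
Import numFieldNormedType.Exports.
Local Open Scope classical_set_scope.
Local Open Scope ring_scope.

(** * Affine images and half-spaces for the outer measure built from boxes *)

Section affine_images.
Context {R : realType} {n : nat}.
Local Notation V := 'rV[R]_n.
Local Notation Rn := (measurable_rV R n).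
Local Notation mu := (@lebesgue_rV R n).
Local Open Scope ereal_scope.

(** A set of [B] is attached to a base point, while a set of [busemann_feller B] counts at each of
    its points: a large average over v+T makes M_B f large at v, but says nothing about the rest of
    v+T. The cell argument overcomes this: all z+T with z in a small cell still contain the subcell
    carrying the mass, so M_B f is large on a set of positive measure, which remains to be enlarged
    to v+T. As T is only known to contain X[0,1]^n, with 0 at a corner, the operator of F enlarges
    towards one side only; this is why -F is brought in. Open sets are used throughout because the
    level sets are unions over a possibly uncountable family F: openness survives such unions and
    gives the measurability that Tonelli's theorem asks for. Volumes are compared only through
    translations, reflections and dilations, so that the measure of X[0,1]^n cancels. *)

Lemma mu_ge0 (A : set V) : 0 <= mu A.
Proof. exact: lebesgue_outer_ge0. Qed.

Lemma le_mu (A B : set V) : A `<=` B -> mu A <= mu B.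
Proof. exact: le_lebesgue_outer. Qed.

Lemma mu_bigcup_le (A : (set V)^nat) : mu (\bigcup_k A k) <= \sum_(k <oo) mu (A k).
Proof. exact: lebesgue_outer_sigma_subadditive. Qed.

Lemma muU_le (A B : set V) : mu (A `|` B) <= mu A + mu B.
Proof. exact: (outer_measureU2 (@lebesgue_outer R n)). Qed.

Lemma measurable_muP (A : set Rn) :
  measurable A <-> forall X : set V, mu X = mu (X `&` A) + mu (X `&` ~` A).
Proof. by []. Qed.

Lemma mu_box_le (a b : V) : mu (box a b) <= (box_volume a b)%:E.
Proof.
apply: ereal_inf_lbound; exists ([set 0%N], fun=> (a, b)).
  by move=> x xab; exists 0%N.
by rewrite /cover_volume esum_set1// box_volume_ge0.
Qed.

(** The outer measure is an infimum over box covers, so it suffices to enclose the image of each box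
    in a box at most c times larger. Measures of boxes are only ever bounded from above. *)
Lemma mu_image_le (phi : V -> V) (c : R) : (0 < c)%R ->
  (forall a b, exists p : V * V, phi @` box a b `<=` box p.1 p.2 /\
     (box_volume p.1 p.2 <= c * box_volume a b)%R) ->
  forall E : set V, mu (phi @` E) <= c%:E * mu E.
Proof.
move=> c0 phib E.
pose g (p : V * V) := projT1 (cid (phib p.1 p.2)).
have gP p : phi @` box p.1 p.2 `<=` box (g p).1 (g p).2 /\
     (box_volume (g p).1 (g p).2 <= c * box_volume p.1 p.2)%R.
  by rewrite /g; case: (cid _).
rewrite -lee_pdivrMl//; apply: le_ereal_inf_tmp => _ [[D b] bE <-].
rewrite lee_pdivrMl//.
apply: (@le_trans _ _ (cover_volume (D, g \o b))).
  apply: ereal_inf_lbound; exists (D, g \o b) => // _ [x Ex <-].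
  have [k Dk kx] := bE _ Ex; exists k => //=.
  by apply: (gP (b k)).1; exists x.
apply: ub_ereal_sup => _ [X [finX XD] <-].
apply: (@le_trans _ _ (c%:E * \sum_(i \in X) (box_volume (b i).1 (b i).2)%:E)).
  rewrite ge0_mule_fsumr; last by move=> i; exact: box_volume_ge0.
  by apply: lee_fsum => // i _ /=; rewrite lee_fin; exact: (gP (b i)).2.
rewrite lee_pmul2l//.
by apply: ereal_sup_ubound; exists X.
Qed.

Lemma mu_imageE (phi psi : V -> V) (c : R) : (0 < c)%R ->
  cancel phi psi ->
  (forall a b, exists p : V * V, phi @` box a b `<=` box p.1 p.2 /\
     (box_volume p.1 p.2 <= c * box_volume a b)%R) ->
  (forall a b, exists p : V * V, psi @` box a b `<=` box p.1 p.2 /\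
     (box_volume p.1 p.2 <= c^-1 * box_volume a b)%R) ->
  forall E : set V, mu (phi @` E) = c%:E * mu E.
Proof.
move=> c0 phiK phib psib E; apply/eqP; rewrite eq_le mu_image_le//=.
rewrite -lee_pdivlMl//.
have -> : E = psi @` (phi @` E).
  rewrite image_comp (_ : psi \o phi = id) ?image_id//.
  by apply/funext => x /=; rewrite phiK.
rewrite [X in _ * mu X](_ : _ = phi @` E).
  by apply: mu_image_le; rewrite ?invr_gt0.
congr image; rewrite image_comp (_ : psi \o phi = id) ?image_id//.
by apply/funext => x /=; rewrite phiK.
Qed.

Lemma measurable_image (phi psi : V -> V) (c : R) :
  cancel phi psi -> cancel psi phi -> (0 < c)%R ->
  (forall E : set V, mu (phi @` E) = c%:E * mu E) ->
  forall A : set Rn, measurable A -> measurable (phi @` A : set Rn).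
Proof.
move=> phiK psiK c0 muphi A /measurable_muP mA; apply/measurable_muP => X.
have phiI (B C : set V) : phi @` B `&` phi @` C = phi @` (B `&` C).
  apply/seteqP; split => [_ [[x Bx <-] [y Cy /(can_inj phiK)]]|_ [x [Bx Cx] <-]].
    by move=> yx; exists x => //; split=> //; rewrite -yx.
  by split; exists x.
have XE : X = phi @` (psi @` X).
  rewrite image_comp (_ : phi \o psi = id) ?image_id//.
  by apply/funext => x /=; rewrite psiK.
have CE : ~` (phi @` A) = phi @` (~` A).
  apply/seteqP; split=> [x nx|_ [x nx <-] [y Ay /(can_inj phiK) yx]].
    exists (psi x); rewrite ?psiK// => Ax; apply: nx; exists (psi x) => //.
  by apply: nx; rewrite -yx.
rewrite CE XE !phiI !muphi (mA (psi @` X)).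
by rewrite ge0_muleDr//; exact: mu_ge0.
Qed.

Lemma box_volume_affine (s : R) (v a b : V) : s != 0%R ->
  exists p : V * V, (fun x => s *: x + v)%R @` box a b `<=` box p.1 p.2 /\
     (box_volume p.1 p.2 <= `|s| ^+ n * box_volume a b)%R.
Proof.
move=> s0.
have volE (a' b' : V) : (forall i, b' ord0 i - a' ord0 i =
    `|s| * (b ord0 i - a ord0 i))%R ->
    (box_volume a' b' <= `|s| ^+ n * box_volume a b)%R.
  move=> ab; rewrite /box_volume -[X in (`|s| ^+ X)%R]card_ord -prodr_const.
  rewrite -big_split/= le_eqVlt; apply/orP; left; apply/eqP.
  by apply: eq_bigr => i _; rewrite ab maxr_pMr// mulr0.
have [sp|sn|s00] := ltgtP s 0%R.
- exists (s *: b + v, s *: a + v)%R; split.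
    move=> _ [x xab <-] i /=; have /andP[ax xb] := xab i; rewrite !mxE.
    by rewrite !lerD2r !ler_nM2l// ax xb.
  by apply: volE => i /=; rewrite ltr0_norm// !mxE; ring.
- exists (s *: a + v, s *: b + v)%R; split.
    move=> _ [x xab <-] i /=; have /andP[ax xb] := xab i; rewrite !mxE.
    by rewrite !lerD2r !ler_pM2l// ax xb.
  by apply: volE => i /=; rewrite gtr0_norm// !mxE; ring.
- by rewrite s00 eqxx in s0.
Qed.

Lemma affineK (s : R) (v : V) : s != 0%R ->
  cancel (fun x => s *: x + v)%R (fun x => s^-1 *: x + (- (s^-1 *: v)))%R.
Proof.
move=> s0 x; rewrite /= scalerDr scalerA mulVf// scale1r -addrA subrr addr0//.
Qed.

Lemma affineKV (s : R) (v : V) : s != 0%R ->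
  cancel (fun x => s^-1 *: x + (- (s^-1 *: v)))%R (fun x => s *: x + v)%R.
Proof.
by move=> s0 x; rewrite /= scalerBr !scalerA mulfV// !scale1r subrK.
Qed.

Lemma mu_affine (s : R) (v : V) (E : set V) : s != 0%R ->
  mu ((fun x => s *: x + v)%R @` E) = (`|s| ^+ n)%:E * mu E.
Proof.
move=> s0; apply: (mu_imageE _ (affineK v s0)).
- by rewrite exprn_gt0// normr_gt0.
- by move=> a b; exact: box_volume_affine.
- move=> a b; rewrite -exprVn -normfV; apply: box_volume_affine.
  by rewrite invr_eq0.
Qed.

Lemma measurable_affine (s : R) (v : V) (A : set Rn) : s != 0%R ->
  measurable A -> measurable ((fun x : V => s *: x + v)%R @` A : set Rn).
Proof.
move=> s0; apply: (measurable_image (affineK v s0) (affineKV v s0)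
  (c := (`|s| ^+ n)%R)).
- by rewrite exprn_gt0// normr_gt0.
- by move=> E; exact: mu_affine.
Qed.

Lemma measurable_halfspace (i : 'I_n) (c : R) :
  measurable ([set x : V | (c < x ord0 i)%R] : set Rn).
Proof.
apply: le_caratheodory_measurable => X.
pose upd (a : V) t : V := \row_j if j == i then t else a ord0 j.
(* [l] and [r] cut a box along the hyperplane x_i = c. Both keep the face on it, which costs no
   volume; a box on one side gets a partner of volume 0, since [box_volume] truncates at 0. *)
pose l (p : V * V) := (p.1, upd p.2 (Num.min (p.2 ord0 i) c)).
pose r (p : V * V) := (upd p.1 (Num.max (p.1 ord0 i) c), p.2).
have volE (a b : V) : (box_volume a b = Num.max 0 (b ord0 i - a ord0 i) *
    \prod_(j < n | j != i) Num.max 0 (b ord0 j - a ord0 j))%R.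
  by rewrite /box_volume (bigD1 i).
have volD p : (box_volume (r p).1 (r p).2 + box_volume (l p).1 (l p).2 =
    box_volume p.1 p.2)%R.
  rewrite !volE/= !mxE eqxx.
  rewrite [X in (_ * X + _)%R](_ : _ =
      \prod_(j < n | j != i) Num.max 0 (p.2 ord0 j - p.1 ord0 j))%R; last first.
    by apply: eq_bigr => j /negbTE ji; rewrite !mxE ji.
  rewrite [X in (_ + _ * X = _)%R](_ : _ =
      \prod_(j < n | j != i) Num.max 0 (p.2 ord0 j - p.1 ord0 j))%R; last first.
    by apply: eq_bigr => j /negbTE ji; rewrite !mxE ji.
  rewrite -mulrDl; congr (_ * _)%R.
  move: (p.1 ord0 i) (p.2 ord0 i) => a b.
  have [ac|/ltW ca] := leP a c; have [bc|/ltW cb] := leP b c.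
  - by rewrite max_l ?add0r// subr_le0.
  - by rewrite !max_r ?subr_ge0// ?subrKA// (le_trans ac).
  - by rewrite max_l ?add0r// subr_le0 (le_trans bc).
  - by rewrite addrC max_l ?add0r// subr_le0.
apply: le_ereal_inf_tmp => _ [[D b] bX <-].
rewrite /cover_volume/= -(eq_esum (fun k _ => congr1 EFin (volD (b k)))).
rewrite (eq_esum (fun k _ => EFinD _ _)) esumD; [|by move=> *; exact: box_volume_ge0..].
apply: leeD; apply: ereal_inf_lbound.
  exists (D, r \o b) => // x [/bX[k Dk kx] /= cx]; exists k => //= j.
  rewrite !mxE; have := kx j; case: eqP => // -> /andP[ax xb].
  by rewrite xb andbT ge_max ax ltW.
exists (D, l \o b) => // x [/bX[k Dk kx] /= /negP]; rewrite -leNgt => cx.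
exists k => //= j; rewrite !mxE; have := kx j; case: eqP => // -> /andP[ax xb].
by rewrite ax/= le_min xb.
Qed.

Lemma measurable_coord (i : 'I_n) :
  measurable_fun [set: Rn] (fun x : Rn => (x : V) ord0 i).
Proof.
move=> _; apply: (measurability _ (RGenOInfty.measurableE R)) => //.
move=> _ [_ [c ->] <-]; apply: measurableI => //; rewrite preimage_itvoy.
exact: measurable_halfspace.
Qed.

Lemma measurable_box_preimage d (T : measurableType d) (g : T -> V) (a b : V) :
  (forall i, measurable_fun setT (fun t => g t ord0 i)) ->
  measurable (g @^-1` box a b).
Proof.
move=> mg; rewrite (_ : g @^-1` _ =
    \bigcap_(i in [set: 'I_n]) ((fun t => g t ord0 i) @^-1` `[a ord0 i, b ord0 i])).
  apply: fin_bigcap_measurable => // i _; rewrite -[X in measurable X]setTI.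
  by apply: mg => //; exact: measurable_itv.
apply/seteqP; split => [x xab i _ /=|x xab i]; first by rewrite in_itv/= xab.
by have /= := xab i I; rewrite in_itv.
Qed.

End affine_images.

(** * Open sets, cubes and outer regularity *)

Section regularity.
Context {R : realType} {n : nat}.
Local Notation V := 'rV[R]_n.
Local Notation Rn := (measurable_rV R n).
Local Notation mu := (@lebesgue_rV R n).
Local Open Scope ereal_scope.

Definition cube (x : V) (r : R) : set V :=
  [set y | forall i, (`|y ord0 i - x ord0 i| < r)%R].

Lemma rV_openP (U : set V) :
  open U <-> forall x, U x -> exists2 e, (0 < e)%R & cube x e `<=` U.
Proof.
rewrite openE; split => [oU x /oU /nbhs_ballP[e /= e0 xU]|oU x /oU[e e0 xU]].
  exists e => // y xy; apply: xU; split => // i j.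
  by rewrite ord1 /ball/= distrC; exact: xy.
apply/nbhs_ballP; exists e => //= y [_ xy]; apply: xU => i.
by have := xy ord0 i; rewrite /ball/= distrC.
Qed.

Lemma cube_center x r : (0 < r)%R -> cube x r x.
Proof. by move=> r0 i; rewrite subrr normr0. Qed.

Lemma cube_trans x y z r s : cube x r y -> cube y s z -> cube x (r + s)%R z.
Proof.
move=> xy yz i; rewrite -(subrK (y ord0 i) (z ord0 i)) -addrA.
rewrite (addrC r s); apply: le_lt_trans (ler_normD _ _) _; exact: ltrD.
Qed.

Lemma cube_sym x y r : cube x r y -> cube y r x.
Proof. by move=> xy i; rewrite distrC. Qed.

Lemma cube_le x r s : (r <= s)%R -> cube x r `<=` cube x s.
Proof. by move=> rs y xy i; rewrite (lt_le_trans (xy i)). Qed.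

Lemma open_coords (a b : V) :
  open [set x : V | forall i, (a ord0 i < x ord0 i < b ord0 i)%R].
Proof.
apply/rV_openP => x xab.
exists (\big[Num.min/1]_i Num.min (x ord0 i - a ord0 i) (b ord0 i - x ord0 i))%R.
  elim/big_ind: _ => //= [u v u0 v0|i _]; rewrite lt_min ?u0//.
  by have /andP[? ?] := xab i; rewrite !subr_gt0; apply/andP.
move=> y xy i; have := xy i => /lt_le_trans.
move=> /(_ _ (@bigmin_le _ _ _ _ i _)); rewrite lt_min ltr_distl => /andP[].
by rewrite ltrBlDl => /andP[? _]; rewrite ltr_distl => /andP[_ ?]; apply/andP; split; lra.
Qed.

Lemma cubeE (x : V) r : cube x r =
  [set y : V | forall i, ((x - const_mx r) ord0 i < y ord0 i < (x + const_mx r) ord0 i)%R].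
Proof.
by apply/seteqP; split => y xy i; have := xy i; rewrite !mxE ltr_distl.
Qed.

Lemma open_cube (x : V) r : open (cube x r).
Proof. by rewrite cubeE; exact: open_coords. Qed.

Lemma cube_box (x : V) r : cube x r `<=` box (x - const_mx r) (x + const_mx r)%R.
Proof. by rewrite cubeE => y xy i; have /andP[? ?] := xy i; rewrite !ltW. Qed.

Lemma mu_cube_lty (x : V) r : mu (cube x r) < +oo.
Proof.
apply: le_lt_trans (le_mu (@cube_box x r)) _.
by rewrite (le_lt_trans (mu_box_le _ _))// ltry.
Qed.

Lemma bounded_cube (S : set V) : bounded_set S -> exists2 M, (0 < M)%R & S `<=` cube 0 M.
Proof.
move=> [M0 [_ SM]]; pose M := (`|M0| + 1)%R.
have {}SM : [set: V] `&` S `<=` [set x | `|x| <= M]%R.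
  by move=> x [_ Sx]; apply: (SM M) => //; rewrite ltr_pwDr// ler_norm.
exists (M + 1)%R; first by have := normr_ge0 M0; rewrite /M => ?; lra.
move=> x Sx i; rewrite mxE subr0; apply: le_lt_trans (_ : M < _)%R; last by rewrite ltrDl.
apply: le_trans (SM x (conj I Sx)); rewrite [leRHS]mx_normrE.
exact: (le_bigmax _ (fun ij => `|x ij.1 ij.2|%R) (ord0, i)).
Qed.

Lemma cube_bounded (S : set V) M : S `<=` cube 0 M -> bounded_set S.
Proof.
move=> SM; exists `|M|%R; split => [|N MN x Sx]; first exact: num_real.
rewrite /= [leLHS]mx_normrE; apply: bigmax_le; first exact: le_trans (ltW MN).
move=> [i j] _; rewrite ord1 /=; apply: ltW; apply: le_lt_trans MN.
by have := SM x Sx j; rewrite mxE subr0 => /ltW/le_trans; apply; exact: ler_norm.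
Qed.

Lemma mu_bounded_lty (S : set V) : bounded_set S -> mu S < +oo.
Proof.
by move=> /bounded_cube[M _ /le_mu/le_lt_trans]; apply; exact: mu_cube_lty.
Qed.

(** Boxes with rational centres and half-sides 1/(k+1) form a countable family. Hence preimages of
    open sets under maps with measurable coordinates are measurable, in particular under the
    difference map on [Rn * Rn]. *)
Lemma open_bigcup_box (U : set V) : open U -> exists P (c : nat -> V * V),
  U = \bigcup_(k in P) box (c k).1 (c k).2.
Proof.
move=> /rV_openP oU.
pose T := ('rV[rat]_n * nat)%type.
pose g (t : T) : V * V := (map_mx ratr t.1 - const_mx t.2.+1%:R^-1,
                           map_mx ratr t.1 + const_mx t.2.+1%:R^-1)%R.
(* Codes that decode to nothing give the box {0}, which is kept only if it lies in [U]. *)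
pose c k : V * V := if unpickle k is Some t then g t else (0, 0)%R.
exists [set k | box (c k).1 (c k).2 `<=` U], c; apply/seteqP; split; last first.
  by move=> x [k /= kU kx]; exact: kU.
move=> x /oU[e e0 xU].
have [k ke] : exists k, (2 / k.+1%:R < e)%R.
  have [k] := @ltr_add_invr R 0 (e / 2) (divr_gt0 e0 (ltr0Sn _ 1)).
  by rewrite add0r => ke; exists k; rewrite mulrC -ltr_pdivlMr.
have k0 : (0 < k.+1%:R^-1 :> R)%R by rewrite invr_gt0.
have qP i : exists q : rat, (`|x ord0 i - ratr q| <= k.+1%:R^-1)%R.
  have [|q] := @rat_in_itvoo R (x ord0 i) (x ord0 i + k.+1%:R^-1); first by rewrite ltrDl.
  rewrite in_itv/= => /andP[xq qx]; exists q; rewrite distrC ger0_norm ?subr_ge0 ?ltW//.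
  by rewrite ltrBlDl.
have {qP}[q qP] := choice qP.
have gx : (map_mx ratr (\row_i q i) : V) = (\row_i ratr (q i))%R.
  by apply/rowP => i; rewrite !mxE.
exists (pickle (\row_i q i, k)); rewrite /= /c pickleK /g gx/=.
  move=> y xy; apply: xU => i; have := xy i; have := qP i; rewrite !mxE.
  move: ke k0; move: (k.+1%:R^-1)%R => d ke d0; rewrite ler_norml => /andP[? ?] /andP[? ?].
  by apply: le_lt_trans ke; rewrite ler_norml; apply/andP; split; lra.
move=> i; have := qP i; rewrite !mxE ler_norml.
by move: (k.+1%:R^-1)%R => d /andP[? ?]; apply/andP; split; lra.
Qed.

Lemma measurable_open_preimage d (T : measurableType d) (g : T -> V) (U : set V) :
  open U -> (forall i, measurable_fun setT (fun t => g t ord0 i)) ->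
  measurable (g @^-1` U).
Proof.
move=> /open_bigcup_box[P [c ->]] mg; rewrite preimage_bigcup.
by apply: bigcup_measurable => k _; exact: measurable_box_preimage.
Qed.

Lemma open_measurable_rV (U : set V) : open U -> measurable (U : set Rn).
Proof.
by move=> oU; exact: (@measurable_open_preimage _ Rn id _ oU (@measurable_coord R n)).
Qed.

Lemma box_volume_enlarge (a b : V) (e : R) : (0 < e)%R -> exists2 d, (0 < d)%R &
  (box_volume (a - const_mx d) (b + const_mx d) <= box_volume a b + e)%R.
Proof.
(* [F i d] dominates the truncated side of the enlarged box and is affine in [d]; at 0 the product
   is the original volume. *)
move=> e0; pose F i (d : R) := (Num.max 0 (b ord0 i - a ord0 i) + 2 * d)%R.
have cF : (\prod_(i < n) F i d @[d --> (0 : R)] --> \prod_(i < n) F i 0)%R.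
  apply: cvg_big => [|i _]; first by move=> x; exact: mul_continuous.
  rewrite /F; apply: cvgD; first exact: cvg_cst.
  by apply: cvgM; [exact: cvg_cst|exact: cvg_id].
have F0 : (\prod_(i < n) F i 0 = box_volume a b)%R.
  by apply: eq_bigr => i _; rewrite /F mulr0 addr0.
have /nbhs_ballP[d /= d0 dF] : \forall d \near (0%R : R), (\prod_(i < n) F i d < box_volume a b + e)%R.
  by apply: (cvgr_lt _ cF); rewrite F0 ltrDl.
exists (d / 2)%R; first by rewrite divr_gt0.
apply: le_trans (ltW (dF (d / 2)%R _)); last first.
  by rewrite /ball/= sub0r normrN ger0_norm ?ltW//; lra.
apply: ler_prod => i _; rewrite le_max lexx/= /F !mxE ge_max.
have : (0 <= Num.max 0 (b ord0 i - a ord0 i))%R by rewrite le_max lexx.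
have : (b ord0 i - a ord0 i <= Num.max 0 (b ord0 i - a ord0 i))%R by rewrite le_max lexx orbT.
by move=> *; apply/andP; split; lra.
Qed.

(** Half of [e] pays for an almost optimal box cover, the other half, split as 2^-(k+1), for
    fattening its boxes into open ones. *)
Lemma outer_regular (A : set V) (e : R) : mu A < +oo -> (0 < e)%R ->
  exists O, [/\ open O, A `<=` O & mu O <= mu A + e%:E].
Proof.
move=> Aoo e0; have e20 : (0 < e / 2)%R by rewrite divr_gt0.
have Afin : mu A \is a fin_num by rewrite ge0_fin_numE ?mu_ge0.
have [_ [[D b] Ab <-] bA] := lb_ereal_inf_adherent e20 Afin.
have dP' k : (0 < e / 2 / (2 ^ k.+1)%:R :> R)%R by rewrite divr_gt0// ltr0n expn_gt0.
have /choice[d dP] : forall k, exists d : R, (0 < d)%R /\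
    (box_volume ((b k).1 - const_mx d) ((b k).2 + const_mx d) <=
     box_volume (b k).1 (b k).2 + e / 2 / (2 ^ k.+1)%:R)%R.
  by move=> k; have [d d0 dk] := box_volume_enlarge (b k).1 (b k).2 (dP' k); exists d.
pose a' k : V := ((b k).1 - const_mx (d k))%R.
pose b' k : V := ((b k).2 + const_mx (d k))%R.
pose O k := [set x : V | forall i, (a' k ord0 i < x ord0 i < b' k ord0 i)%R].
exists (\bigcup_(k in D) O k); split.
- by apply: bigcup_open => k _; exact: open_coords.
- move=> x /Ab[k Dk kx]; exists k => // i; have /andP[? ?] := kx i.
  by have [? _] := dP k; rewrite !mxE; apply/andP; split; lra.
apply: (@le_trans _ _ (cover_volume (D, fun k => (a' k, b' k)))).
  apply: ereal_inf_lbound; exists (D, fun k => (a' k, b' k)) => // x [k Dk kx].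
  by exists k => // i; have /andP[? ?] := kx i; rewrite !ltW.
apply: (@le_trans _ _ (cover_volume (D, b) + (e / 2)%:E)); last first.
  rewrite [in leRHS](splitr e) EFinD addeA leeD2r//; exact: ltW.
apply: (@le_trans _ _ (\esum_(k in D) ((box_volume (b k).1 (b k).2)%:E
    + (e / 2 / (2 ^ k.+1)%:R)%:E))).
  by apply: le_esum => k _; rewrite -EFinD lee_fin; exact: (dP k).2.
rewrite esumD; last 2 first.
- by move=> *; exact: box_volume_ge0.
- by move=> *; rewrite lee_fin ltW.
rewrite leeD2l//; apply: le_trans (epsilon_trick0 xpredT (ltW e20)).
rewrite nneseries_esumT; last by move=> k; rewrite lee_fin ltW.
rewrite esum_mkcond; apply: le_esum => k _; case: ifP => // _.
by rewrite lee_fin ltW.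
Qed.

Lemma bigcup_cube : \bigcup_k cube (0 : V) k.+1%:R = [set: V].
Proof.
apply/seteqP; split => // x _.
exists (Num.truncn (\big[Num.max/0]_i `|x ord0 i|))%R => // i.
rewrite mxE subr0; apply: le_lt_trans (truncnS_gt _).
exact: (le_bigmax _ (fun i => `|x ord0 i|)%R).
Qed.

Lemma sigma_finite_lebesgue_rV : sigma_finite [set: Rn] mu.
Proof.
exists (fun k => cube 0 k.+1%:R); first by rewrite bigcup_cube.
by move=> k; split; [exact/open_measurable_rV/open_cube | exact: mu_cube_lty].
Qed.

End regularity.

HB.instance Definition _ (R : realType) (n : nat) :=
  Measure_isSigmaFinite.Build _ (measurable_rV R n) R (@lebesgue_rV R n)
    (@sigma_finite_lebesgue_rV R n).

(** * Translations, reflections and the overlap integral *)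

Section translations.
Context {R : realType} {n : nat}.
Local Notation V := 'rV[R]_n.
Local Notation Rn := (measurable_rV R n).
Local Notation mu := (@lebesgue_rV R n).
Local Open Scope ereal_scope.

Definition translate (v : V) (S : set V) : set V := [set y + v | y in S]%R.
Definition reflect (S : set V) : set V := [set - y | y in S]%R.

Lemma translateP v S x : translate v S x <-> S (x - v)%R.
Proof.
split=> [[y Sy <-]|Sx]; first by rewrite addrK.
by exists (x - v)%R => //; rewrite subrK.
Qed.

Lemma reflectP S x : reflect S x <-> S (- x)%R.
Proof.
split=> [[y Sy <-]|Sx]; first by rewrite opprK.
by exists (- x)%R => //; rewrite opprK.
Qed.

Lemma translateE v S : translate v S = (fun x => 1 *: x + v)%R @` S.
Proof. by apply: eq_imagel => x _; rewrite scale1r. Qed.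

Lemma reflectE S : reflect S = (fun x => -1 *: x + 0)%R @` S.
Proof. by apply: eq_imagel => x _; rewrite scaleN1r addr0. Qed.

Lemma mu_translate v S : mu (translate v S) = mu S.
Proof.
by rewrite translateE mu_affine ?oner_eq0// normr1 expr1n mul1e.
Qed.

Lemma mu_reflect S : mu (reflect S) = mu S.
Proof.
by rewrite reflectE mu_affine ?oppr_eq0 ?oner_eq0// normrN1 expr1n mul1e.
Qed.

Lemma measurable_translate v (S : set Rn) : measurable S -> measurable (translate v S : set Rn).
Proof. by rewrite translateE; apply: measurable_affine; rewrite oner_eq0. Qed.

Lemma measurable_reflect (S : set Rn) : measurable S -> measurable (reflect S : set Rn).
Proof. by rewrite reflectE; apply: measurable_affine; rewrite oppr_eq0 oner_eq0. Qed.

Lemma open_translate v S : open S -> open (translate v S).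
Proof.
move=> /rV_openP oS; apply/rV_openP => x /translateP/oS[e e0 eS].
exists e => // y xy; apply/translateP/eS => i; have := xy i.
by rewrite !mxE opprB addrA subrK.
Qed.

Lemma open_reflect S : open S -> open (reflect S).
Proof.
move=> /rV_openP oS; apply/rV_openP => x /reflectP/oS[e e0 eS].
exists e => // y xy; apply/reflectP/eS => i; have := xy i.
by rewrite !mxE -opprD normrN.
Qed.

(** The section at t is the overlap of D with t + A; the section at a point x of D is x - A. For
    open A, measurability comes from the difference map. *)
Let sheared (A D : set V) : set (Rn * Rn) := [set p | D p.2 /\ A (p.2 - p.1 : V)%R].

Let measurable_sheared (A : set V) (D : set Rn) : open A -> measurable D ->
  measurable (sheared A D).
Proof.
move=> oA mD.
rewrite (_ : sheared A D = ([set: Rn] `*` D) `&` (fun p : Rn * Rn => (p.2 - p.1 : V)%R) @^-1` A).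
  apply: measurableI; first exact: measurableX.
  apply: measurable_open_preimage => // i.
  under eq_fun do rewrite !mxE.
  apply: measurable_funB.
    exact: (measurableT_comp (@measurable_coord R n i) measurable_snd).
  exact: (measurableT_comp (@measurable_coord R n i) measurable_fst).
by apply/seteqP; split => p /=; rewrite /sheared/=; tauto.
Qed.

Let xsection_sheared (A D : set V) (t : Rn) :
  xsection (sheared A D) t = D `&` translate t A.
Proof.
apply/seteqP; split => x; rewrite /xsection/= inE.
  by move=> [/= ? ?]; split => //; apply/translateP.
by move=> [? /translateP].
Qed.

Lemma measurable_mu_translateI (A : set V) (D : set Rn) : open A -> measurable D ->
  measurable_fun [set: Rn] (fun t : Rn => mu (D `&` translate t A)).
Proof.
move=> oA mD; have := measurable_fun_xsection mu (measurable_sheared oA mD).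
by congr measurable_fun; apply/funext => t /=; rewrite xsection_sheared.
Qed.

(* Tonelli for the indicator of [sheared A D]. *)
Lemma integral_mu_translateI (A : set V) (D : set Rn) : open A -> measurable D ->
  \int[mu]_(t in [set: Rn]) mu (D `&` translate t A) = mu D * mu A.
Proof.
move=> oA mD; pose E := sheared A D.
have mE : measurable E by exact: measurable_sheared.
have := indic_fubini_tonelli mu mu mE.
rewrite indic_fubini_tonelli_FE// indic_fubini_tonelli_GE//.
rewrite (eq_integral (fun t : Rn => mu (D `&` translate t A))); last first.
  by move=> t _ /=; rewrite xsection_sheared.
move=> ->; rewrite (eq_integral (fun x : Rn => mu A * (\1_D x)%:E)); last first.
  move=> x _ /=; rewrite indicE; case: (boolP (x \in D)) => [/set_mem Dx|/negP Dx].
    rewrite mule1 -(mu_reflect A) -(mu_translate (x : V) (reflect A)); congr mu.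
    apply/seteqP; split => t; rewrite /ysection/= inE /E/=.
      by move=> [_ ?]; apply/translateP/reflectP; rewrite opprB.
    by move=> /translateP/reflectP; rewrite opprB.
  rewrite mule0 -[RHS](lebesgue_outer0 (R := R) (n := n)); congr mu.
  apply/seteqP; split => // t; rewrite /ysection/= inE /E/= => -[Dx' _].
  by apply: Dx; exact/mem_set.
rewrite ge0_integralZl//; last first.
  by apply/measurable_EFinP; exact: measurable_indic.
by rewrite integral_indic// setIT muleC.
Qed.
End translations.

(** * Absolute continuity of the integral *)

Section integral_continuity.
Context d (T : measurableType d) (R : realType) (nu : {measure set T -> \bar R}).
Variable f : T -> R.
Hypothesis intf : nu.-integrable [set: T] (EFin \o f).
Local Open Scope ereal_scope.

Let mf : measurable_fun [set: T] f.
Proof. exact/measurable_EFinP/measurable_int/intf. Qed.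

Let intA (A : set T) : measurable A -> nu.-integrable A (EFin \o f).
Proof. by move=> mA; exact: integrableS intf. Qed.

(** Dominated convergence makes the integral of |f| over {|f| > k} less than e/2 for some k; on the
    rest of A, |f| is at most k. *)
Lemma integral_abs_continuous (e : R) : (0 < e)%R -> exists2 r : R, (0 < r)%R &
  forall A, measurable A -> nu A < r%:E -> \int[nu]_(x in A) `|f x|%:E < e%:E.
Proof.
move=> e0.
pose E k := [set x | (k%:R < `|f x|)%R].
have mE k : measurable (E k).
  rewrite -[X in measurable X]setTI.
  have mnf : measurable_fun [set: T] (fun x => `|f x|%R) by exact: measurableT_comp.
  by have := mnf measurableT _ (measurable_itv `]k%:R, +oo[); rewrite preimage_itvoy.
have mnf A : measurable_fun A (fun x => `|f x|%:E).
  apply/measurable_EFinP; apply: measurable_funTS; exact: measurableT_comp.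
have cE : \int[nu]_(x in [set: T]) (`|f x| * \1_(E k) x)%:E @[k --> \oo] -->
    \int[nu]_(x in [set: T]) cst 0 x.
  apply: (@dominated_cvg _ _ _ _ _ measurableT _ _ (fun x => `|f x|%:E)) => //=.
  - move=> k; apply/measurable_EFinP; apply: measurable_funM.
      exact: measurableT_comp.
    exact: measurable_indic.
  - move=> x _; apply/cvg_EFin => //=; first by apply: nearW.
    apply: (cvg_near_cst 0%R).
    exists (Num.truncn `|f x|).+1 => // k /= xk.
    rewrite indicE memNset ?mulr0//= /E/= => /lt_trans/(_ (truncnS_gt _)).
    by rewrite ltr_nat ltnNge (leq_trans _ xk).
  - exact: integrable_norm.
  - move=> k x _; rewrite lee_fin normrM normr_id ler_piMr//.
    by rewrite indicE; case: (_ \in _); rewrite ?normr1// normr0.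
rewrite integral0 in cE.
have e20 : (0 < e / 2)%R by rewrite divr_gt0.
have [k _ /(_ k (leqnn _)) /= Ek] : \forall k \near \oo,
    \int[nu]_(x in [set: T]) (`|f x| * \1_(E k) x)%:E < (e / 2)%:E.
  by apply: (cE [set y | y < (e / 2)%:E]); apply: open_ereal_lt'; rewrite lte_fin.
exists (e / 2 / k.+1%:R)%R; first by rewrite divr_gt0.
move=> A mA Ar.
have mAE : measurable (A `&` E k) by exact: measurableI.
have mAD : measurable (A `\` E k) by exact: measurableD.
rewrite -(setUIDK A (E k)) ge0_integral_setU//; last first.
  by rewrite disj_set2E; apply/eqP/seteqP; split => // x [[_ ?] [_ ?]].
rewrite (splitr e) EFinD; apply: lteD.
  apply: le_lt_trans Ek.
  rewrite integral_mkcond; apply: ge0_le_integral => //.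
  - by move=> x _; rewrite patchE; case: ifP => // _; rewrite lee_fin.
  - exact: ((measurable_restrictT (fun x => `|f x|%:E) mAE).1 (mnf _)).
  - apply/measurable_EFinP; apply: measurable_funM => //.
    exact: measurableT_comp.
  move=> x _; rewrite patchE; case: ifPn => [/set_mem[_ xE]|_].
    by rewrite indicE mem_set// mulr1.
  by rewrite lee_fin mulr_ge0.
apply: (@le_lt_trans _ _ (\int[nu]_(x in A `\` E k) (cst k%:R%:E) x)).
  apply: ge0_le_integral => // x [_ /negP]; rewrite -leNgt => ?.
  by rewrite lee_fin.
rewrite integral_cst//.
apply: (@le_lt_trans _ _ (k.+1%:R%:E * nu A)).
  by apply: lee_pmul => //; [rewrite lee_fin ler_nat|apply: le_measure; rewrite ?inE].
by rewrite -lte_pdivlMl// -EFinM mulrC.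
Qed.

Lemma le_integral_symdiff (A B : set T) : measurable A -> measurable B ->
  \int[nu]_(x in A) (f x)%:E <= \int[nu]_(x in B) (f x)%:E +
    (\int[nu]_(x in A `\` B) `|f x|%:E + \int[nu]_(x in B `\` A) `|f x|%:E).
Proof.
move=> mA mB.
have mAI : measurable (A `&` B) by exact: measurableI.
have mAD : measurable (A `\` B) by exact: measurableD.
have mBD : measurable (B `\` A) by exact: measurableD.
have mfA D : measurable_fun D (EFin \o f).
  by apply/measurable_EFinP; exact: measurable_funTS.
have splitI C D : measurable C -> measurable D ->
    \int[nu]_(x in C) (f x)%:E = \int[nu]_(x in C `&` D) (f x)%:E +
    \int[nu]_(x in C `\` D) (f x)%:E.
  move=> mC mD; rewrite -[in LHS](setUIDK C D) integral_setU//;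
    do ?[exact: measurableI|exact: measurableD|exact: mfA].
  by rewrite disj_set2E; apply/eqP/seteqP; split => // x [[_ ?] [_ ?]].
rewrite (splitI A B)// (splitI B A)// (setIC B A) -addeA leeD2l//.
have absle D : measurable D -> `|\int[nu]_(x in D) (f x)%:E| <=
    \int[nu]_(x in D) `|f x|%:E.
  by move=> mD; apply: le_trans (le_abse_integral _ mD (mfA D)) _.
have fin D : measurable D -> \int[nu]_(x in D) (f x)%:E \is a fin_num.
  by move=> mD; apply: integrable_fin_num => //; exact: intA.
have /= h1 := absle _ mAD; have /= h2 := absle _ mBD.
rewrite addeCA; apply: le_trans (leeDl _ _).
  exact: le_trans (lee_abs _) h1.
rewrite addeC -leeBlDr ?fin// sub0e; apply: le_trans h2.
by rewrite -abseN lee_abs.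
Qed.

End integral_continuity.

(** * Continuity of integrals over moving sets *)

Section moving_averages.
Context {R : realType} {n : nat}.
Local Notation V := 'rV[R]_n.
Local Notation Rn := (measurable_rV R n).
Local Notation mu := (@lebesgue_rV R n).
Local Open Scope ereal_scope.

(** The points whose cube of half-side 1/(k+1) stays in O exhaust O, and continuity of the measure
    from below keeps the strict bound. The margin e lets C be shifted slightly without leaving O. *)
Lemma open_erosion (A : set Rn) (O : set V) (c : \bar R) :
  measurable A -> open O -> c < mu (A `&` O) ->
  exists (C : set V) (e : R), [/\ (0 < e)%R, measurable (C : set Rn), C `<=` A `&` O,
    c < mu C & forall x, C x -> cube x e `<=` O].
Proof.
move=> mA oO cAO.
pose W k : set Rn := [set x : V | cube x k.+1%:R^-1 `<=` O].
have mW k : measurable (W k).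
  rewrite -[W k]setCK; apply: measurableC; apply: open_measurable_rV.
  rewrite (_ : ~` W k = \bigcup_(z in ~` O) cube z k.+1%:R^-1).
    by apply: bigcup_open => z _; exact: open_cube.
  apply/seteqP; split => [x /existsNP[z /not_implyP[xz Oz]]|x [z Oz zx] xO].
    by exists z => //; exact: cube_sym.
  by apply/Oz/xO; exact: cube_sym.
have WU : \bigcup_k (A `&` W k) = A `&` O.
  rewrite -setI_bigcupr; congr (_ `&` _); apply/seteqP; split => [x [k _ xk]|x Ox].
    by apply: xk; apply: cube_center; rewrite invr_gt0.
  have /rV_openP/(_ _ Ox)[e e0 xe] := oO.
  have [k] := @ltr_add_invr R 0 e e0; rewrite add0r => ke.
  by exists k => //; apply: subset_trans xe; apply: cube_le; exact: ltW.
have mAO k : measurable (A `&` W k) by exact: measurableI.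
have mU : measurable (\bigcup_k (A `&` W k)) by exact: bigcup_measurable.
have nd : nondecreasing_seq (fun k => A `&` W k).
  apply/nondecreasing_seqP => k; apply/subsetPset => x [Ax xk]; split => //.
  by apply: subset_trans xk; apply: cube_le; rewrite lef_pV2 ?posrE// ler_nat.
have := nondecreasing_cvg_mu (mu := mu) mAO mU nd.
rewrite WU => cvgA.
have [k _ /(_ k (leqnn _)) /= ck] : \forall k \near \oo, c < mu (A `&` W k).
  by apply: (cvgA [set y | c < y]); exact: open_ereal_gt'.
exists (A `&` W k), (k.+1%:R^-1)%R; split => //.
- move=> x [Ax xk]; split => //.
  by apply: xk; apply: cube_center; rewrite invr_gt0.
- by move=> x [_ xk].
Qed.

(** Take an open O around T and an eroded C inside T: a point of C moved by -h stays in O, so what T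
    loses lies in T minus C or in h + (O minus T). The budget is e/2 + e/4 < e. *)
Lemma mu_translateD (T : set Rn) (e : R) : measurable T -> mu T < +oo -> (0 < e)%R ->
  exists2 r : R, (0 < r)%R &
    forall h, cube 0 r h -> mu (T `\` translate h T) < e%:E.
Proof.
move=> mT Too e0.
have e20 : (0 < e / 2)%R by rewrite divr_gt0.
have e40 : (0 < e / 4)%R by rewrite divr_gt0.
have Tfin : mu T \is a fin_num by rewrite ge0_fin_numE ?mu_ge0.
have [ O [oO TO Oe]] := outer_regular Too e40.
have mO := open_measurable_rV oO.
have OTe : mu (O `\` T) <= (e / 4)%:E.
  have := measureDI mu mO mT; rewrite (setIidr TO) => Osplit.
  by move: Oe; rewrite Osplit addeC leeD2lE.
have [|C [r [r0 mC CTO Ce CO]]] := @open_erosion T O (mu T - (e / 2)%:E) mT oO.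
  by rewrite (setIidl TO) lteBlDr// lteDl// lte_fin.
have CT : C `<=` T by move=> x /CTO[].
exists r => // h h0.
apply: (@le_lt_trans _ _ (mu (T `\` C) + mu (translate h (O `\` T)))).
  apply: le_trans (muU_le _ _); apply: le_mu => x [Tx Tx'].
  case: (pselect (C x)) => Cx; [right|by left].
  apply/translateP; split; last by move=> ?; apply: Tx'; apply/translateP.
  by apply: (CO x Cx) => i; have := h0 i; rewrite !mxE subr0 addrAC subrr add0r normrN.
rewrite mu_translate.
have := measureDI mu mT mC; rewrite (setIidr CT) => Tsplit.
have TC : mu (T `\` C) <= (e / 2)%:E.
  have Cfin : mu C \is a fin_num.
    by rewrite ge0_fin_numE ?mu_ge0// (le_lt_trans (le_mu CT)).
  move/ltW: Ce; rewrite leeBlDr// Tsplit addeC leeD2lE//.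
apply: le_lt_trans (leeD TC OTe) _.
by rewrite -EFinD lte_fin; lra.
Qed.

Lemma open_integral_translate (f : Rn -> R) (T : set Rn) (c : R) :
  lebesgue_integrable f -> measurable T -> mu T < +oo ->
  open [set x : V | c%:E < \int[mu]_(y in translate x T) (f y)%:E].
Proof.
move=> intf mT Too; apply/rV_openP => x /= cx.
have mTx y : measurable (translate y T : set Rn) by exact: measurable_translate.
have fin (A : set Rn) : measurable A -> \int[mu]_(y in A) (f y)%:E \is a fin_num.
  by move=> mA; apply: integrable_fin_num => //; exact: integrableS intf.
move: cx; rewrite -(fineK (fin _ (mTx x))) lte_fin -subr_gt0.
set e := (X in (0 < X)%R) => e0.
have [|s s0 se] := integral_abs_continuous intf (e := (e / 2)%R); first exact: divr_gt0.
have [r r0 rs] := mu_translateD mT Too s0.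
exists r => // y xy /=.
have diff (u v : V) : cube 0 r (u - v)%R ->
    \int[mu]_(z in translate v T `\` translate u T) `|f z|%:E < (e / 2)%:E.
  move=> uv; apply: se; first exact: measurableD.
  apply: le_lt_trans (rs _ uv); rewrite -(mu_translate v (_ `\` _)).
  apply: le_mu => z [/translateP vz uz]; apply/translateP; split => //.
  move=> /translateP vuz; apply: uz; apply/translateP.
  by move: vuz; rewrite opprB addrA subrK.
have yx1 : cube 0 r (y - x)%R by move=> i; have := xy i; rewrite !mxE subr0.
have yx2 : cube 0 r (x - y)%R.
  by move=> i; have := xy i; rewrite !mxE subr0 distrC.
have : \int[mu]_(z in translate x T) (f z)%:E <
    \int[mu]_(z in translate y T) (f z)%:E + e%:E.
  apply: le_lt_trans (le_integral_symdiff intf (mTx x) (mTx y)) _.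
  by rewrite lteD2lE ?fin// (splitr e) EFinD; apply: lteD; apply: diff.
rewrite -(fineK (fin _ (mTx x))) -(fineK (fin _ (mTx y))) -EFinD !lte_fin.
by rewrite /e; lra.
Qed.

End moving_averages.

(** * Measurability for translation invariant bases *)

Section translation_invariant_bases.
Context {R : realType} {n : nat}.
Local Notation V := 'rV[R]_n.
Local Notation Rn := (measurable_rV R n).
Local Notation mu := (@lebesgue_rV R n).
Local Open Scope ereal_scope.
Implicit Types (B : diff_basis R n) (f : Rn -> R).

Lemma translate0 (S : set V) : translate 0 S = S.
Proof. by apply/seteqP; split => x; rewrite translateP subr0. Qed.

Lemma translateD (u v : V) (S : set V) : translate u (translate v S) = translate (u + v)%R S.
Proof. by apply/seteqP; split => x; rewrite !translateP opprD addrA. Qed.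

Lemma diam_le_translate (v : V) (S : set V) : diam (translate v S) <= diam S.
Proof.
apply: ub_ereal_sup => _ [[p q] [/= /translateP Sp /translateP Sq] <-].
apply: ereal_sup_ubound; exists ((p - v)%R, (q - v)%R) => //=.
by rewrite opprB addrA subrK.
Qed.

Lemma diam_translate (v : V) (S : set V) : diam (translate v S) = diam S.
Proof.
apply/eqP; rewrite eq_le diam_le_translate/=.
by rewrite -[in leLHS](translate0 S) -(addNr v) -translateD diam_le_translate.
Qed.

Lemma basis_lt_translate B x (r : \bar R) S : translation_invariant B ->
  basis_lt B x r S <-> exists2 T, basis_lt B 0%R r T & S = translate x T.
Proof.
move=> tB; split=> [[BS Sr]|[T [BT Tr] ->]].
  exists (translate (- x)%R S).
    split; last by rewrite diam_translate.
    by have := tB (- x)%R x S BS; rewrite subrr.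
  by rewrite translateD subrr translate0.
split; last by rewrite diam_translate.
by have := tB x 0%R T BT; rewrite add0r.
Qed.

Lemma busemann_feller_translation_invariant B :
  translation_invariant B -> translation_invariant (busemann_feller B).
Proof.
move=> tB v x S [[y _ BS] Sx]; split; last by exists x.
by exists (y + v)%R => //; exact: tB.
Qed.

Lemma basis_mu_lty B x S : B x S -> mu S < +oo.
Proof. by case/basis_atP => bS _ _ _; exact: mu_bounded_lty. Qed.

Lemma lt_average f (S : set Rn) (c : R) : 0 < mu S -> mu S < +oo ->
  (c%:E < average f S) = (c%:E * mu S < \int[mu]_(y in S) (f y)%:E).
Proof.
move=> S0 Soo; have Sfin : mu S \is a fin_num by rewrite ge0_fin_numE ?mu_ge0.
rewrite /average -(fineK Sfin) inver gt_eqF ?fine_gt0 ?S0//.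
by rewrite lte_pdivlMl ?fine_gt0 ?S0// muleC.
Qed.

Lemma average_lt f (S : set Rn) (c : R) : 0 < mu S -> mu S < +oo ->
  (average f S < c%:E) = (\int[mu]_(y in S) (f y)%:E < c%:E * mu S).
Proof.
move=> S0 Soo; have Sfin : mu S \is a fin_num by rewrite ge0_fin_numE ?mu_ge0.
rewrite /average -(fineK Sfin) inver gt_eqF ?fine_gt0 ?S0//.
by rewrite lte_pdivrMl ?fine_gt0 ?S0// muleC.
Qed.

(** By translation invariance the set is a union, over the sets T of the basis at 0, of sets open by
    [open_integral_translate]. The union may be uncountable, so measurability has to come from
    openness. *)
Lemma open_lt_sup_average B f (r : \bar R) (c : R) : translation_invariant B ->
  lebesgue_integrable f ->
  open [set x : V | exists2 S, basis_lt B x r S & c%:E < average f S].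
Proof.
move=> tB intf.
rewrite (_ : mkset _ = \bigcup_(T in basis_lt B 0%R r)
    [set x : V | (c * fine (mu T))%:E < \int[mu]_(y in translate x T) (f y)%:E]).
  apply: bigcup_open => T [BT _]; have [_ mT _ _] := basis_atP BT.
  by apply: open_integral_translate => //; exact: basis_mu_lty BT.
have avgE x T : B 0%R T -> (c%:E < average f (translate x T)) =
    ((c * fine (mu T))%:E < \int[mu]_(y in translate x T) (f y)%:E).
  move=> BT; have [_ _ T0 _] := basis_atP BT; have Too := basis_mu_lty BT.
  rewrite lt_average ?mu_translate// EFinM fineK//.
  by rewrite ge0_fin_numE ?mu_ge0.
apply/seteqP; split => x /=.
  move=> [S /(basis_lt_translate _ _ _ tB)[T rT ->] cT]; exists T => //=.
  by rewrite -avgE//; case: rT.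
move=> [T rT /= cT]; exists (translate x T); last by rewrite avgE//; case: rT.
by apply/(basis_lt_translate _ _ _ tB); exists T.
Qed.

Lemma measurable_fun_open_gt (g : Rn -> \bar R) :
  (forall c : R, open [set x : V | c%:E < g x]) -> measurable_fun [set: Rn] g.
Proof.
move=> og _; apply: (measurability _ (ErealGenOInfty.measurableE R)) => //.
move=> /= _ [_ [a ->]] <-; apply: measurableI => //.
by rewrite preimage_itvoy; exact: open_measurable_rV.
Qed.

Lemma measurable_sup_average B f (r : \bar R) : translation_invariant B ->
  lebesgue_integrable f -> measurable_fun [set: Rn]
    (fun x => ereal_sup [set average f S | S in basis_lt B x r]).
Proof.
move=> tB intf; apply: measurable_fun_open_gt => c.
rewrite (_ : mkset _ = [set x : V | exists2 S, basis_lt B x r S & c%:E < average f S]).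
  exact: open_lt_sup_average.
apply/seteqP; split => x /=.
  by move=> /ereal_sup_gt[_ [S rS <-] cS]; exists S.
move=> [S rS cS]; apply: lt_le_trans cS _; apply: ereal_sup_ubound.
by exists S.
Qed.

Lemma measurable_upper_derivative B f : translation_invariant B ->
  lebesgue_integrable f -> measurable_fun [set: Rn] (upper_derivative B f).
Proof.
move=> tB intf _; apply: (measurability _ (ErealGenInftyO.measurableE R)) => //.
move=> /= _ [_ [a ->]] <-; apply: measurableI => //.
rewrite preimage_itvNyo.
pose g (e : R) (x : Rn) := ereal_sup [set average f S | S in basis_lt B x e%:E].
(* The inner supremum is monotone in the radius, so the radii 1/(k+1) suffice. *)
rewrite (_ : mkset _ = \bigcup_k [set x : Rn | g (k.+1%:R^-1)%R x < a%:E]).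
  apply: bigcup_measurable => k _; rewrite -[X in measurable X]setTI.
  by apply: emeasurable_fun_infty_o => //; exact: measurable_sup_average.
apply/seteqP; split => x /=.
  move=> /ereal_inf_lt[_ [e /= e0 <-] ea].
  have [k] := @ltr_add_invr R 0 e e0; rewrite add0r => ke.
  exists k => //=; apply: le_lt_trans ea; apply: le_ereal_sup => _ [S [BS Sk] <-].
  by exists S => //; split => //; rewrite (lt_trans Sk)// lte_fin.
move=> [k _ /=]; apply: le_lt_trans; apply: ereal_inf_lbound.
by exists (k.+1%:R^-1)%R => //=; rewrite invr_gt0.
Qed.

Lemma averageN f (S : set Rn) : lebesgue_integrable f -> measurable S ->
  0 < mu S -> average (fun x => - f x)%R S = - average f S.
Proof.
move=> intf mS S0; rewrite /average -muleN; congr (_ * _).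
have iS : mu.-integrable S (EFin \o f) by exact: integrableS intf.
under eq_integral do rewrite EFinN.
by rewrite integralN// fin_num_adde_defl// fin_numN integrable_neg_fin_num.
Qed.

Lemma lower_derivativeN B f x : lebesgue_integrable f ->
  lower_derivative B f x = - upper_derivative B (fun x => - f x)%R x.
Proof.
move=> intf; rewrite /upper_derivative.
rewrite [X in ereal_inf X](_ : _ = -%E @` [set ereal_inf
    [set average f S | S in basis_lt B x e%:E] | e in [set e : R | (0 < e)%R]]).
  by rewrite ereal_infN oppeK.
rewrite image_comp; apply: eq_imagel => e _ /=; rewrite -ereal_supN; congr ereal_sup.
rewrite image_comp; apply: eq_imagel => S [/basis_atP[_ mS S0 _] _] /=.
exact: averageN.
Qed.

Lemma translation_invariant_measurable B : translation_invariant B -> measurable_basis B.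
Proof.
move=> tB f intf; split.
- exact: measurable_upper_derivative.
- rewrite (_ : lower_derivative B f =
      \- (upper_derivative B (fun x => - f x)%R)); last first.
    by apply/funext => x; exact: lower_derivativeN.
  apply: measurableT_comp => //; apply: measurable_upper_derivative => //.
  rewrite /lebesgue_integrable (_ : _ \o _ = -%E \o (EFin \o f)).
    exact: integrableN.
  by apply/funext.
- move=> r _; apply: measurable_sup_average => //; exact: integrable_norm.
Qed.

End translation_invariant_bases.

(** * The halo operator *)

Section halo.
Context {R : realType} {n : nat}.
Local Notation V := 'rV[R]_n.
Local Notation Rn := (measurable_rV R n).
Local Notation mu := (@lebesgue_rV R n).
Local Open Scope ereal_scope.
Implicit Types (F : set (set V)) (O : set V) (lam : R).

(** The level set {M \1_O > lam} for the sets x + T, with the division by [mu T] cleared. Leaving F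
    arbitrary lets the reflected family in as well. *)
Definition halo F lam O : set V :=
  [set x | exists2 T, F T & lam%:E * mu T < mu (translate x T `&` O)].

Lemma halo_subset F F' lam O O' : F `<=` F' -> O `<=` O' ->
  halo F lam O `<=` halo F' lam O'.
Proof.
move=> FF' OO' x [T FT lT]; exists T; first exact: FF'.
by apply: lt_le_trans lT _; apply: le_mu; exact: setIS.
Qed.

Lemma translateI (v : V) (A B : set V) :
  translate v (A `&` B) = translate v A `&` translate v B.
Proof.
by apply/seteqP; split => x; rewrite /setI/= !translateP.
Qed.

Lemma translate_halo F lam O (v : V) :
  translate v (halo F lam O) = halo F lam (translate v O).
Proof.
apply/seteqP; split => x; rewrite translateP => -[T FT lT]; exists T => //;
  move: lT; rewrite -(mu_translate v (translate _ _ `&` O)) translateI translateD;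
  by rewrite (addrC v) subrK.
Qed.

(** The overlap of x + T with O is eroded to a set C with a margin; for y near x, the shift C + (y -
    x) lies in y + T and still in O. *)
Lemma open_halo F lam O : (forall T, F T -> measurable (T : set Rn)) ->
  open O -> open (halo F lam O).
Proof.
move=> mF oO; apply/rV_openP => x [T FT xT].
have mxT : measurable (translate x T : set Rn) by apply/measurable_translate/mF.
have [C [e [e0 mC CTO lC CO]]] := open_erosion mxT oO xT.
exists e => // y xy; exists T => //; apply: lt_le_trans lC _.
rewrite -(mu_translate (y - x)%R C); apply: le_mu => z /translateP Cz; split.
  have [/translateP + _] := CTO _ Cz; move=> Tz; apply/translateP.
  by move: Tz; rewrite opprB addrA addrAC addrK.
apply: CO Cz _ _ => i.
have -> : (z ord0 i - (z - (y - x))%R ord0 i = y ord0 i - x ord0 i)%R by rewrite !mxE; ring.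
exact: xy.
Qed.

Lemma reflect_halo F lam O :
  reflect (halo F lam O) = halo (reflect @` F) lam (reflect O).
Proof.
have h (x : V) T (O' : set V) : mu (translate (- x)%R T `&` O') = mu (translate x (reflect T) `&` reflect O').
  have xy (y : V) : (- y - - x = - (y - x))%R by rewrite opprK opprB addrC.
  rewrite -mu_reflect; congr mu; apply/seteqP; split => y.
    move=> /reflectP[/translateP Tyx Oy]; split; last exact/reflectP.
    by apply/translateP/reflectP; rewrite -xy.
  move=> [/translateP/reflectP Tyx /reflectP Oy]; apply/reflectP; split => //.
  by apply/translateP; rewrite xy.
apply/seteqP; split => x; rewrite reflectP => -[T FT].
  by rewrite h => lT; exists (reflect T); [exists T|rewrite mu_reflect].
move: FT => [S FS <-]; rewrite mu_reflect => lT; exists S => //.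
by rewrite h.
Qed.

Lemma coord_le_eucl_norm (x : V) i : (`|x ord0 i| <= eucl_norm x)%R.
Proof.
rewrite -sqrtr_sqr /eucl_norm ler_wsqrtr// (bigD1 i)//= lerDl.
by apply: sumr_ge0 => j _; exact: sqr_ge0.
Qed.

Lemma diam_lt_cube (T : set V) (r : R) (x y : V) : diam T < r%:E -> T x -> T y -> cube x r y.
Proof.
move=> Tr Tx Ty i; rewrite -lte_fin; apply: le_lt_trans Tr.
apply: (@le_trans _ _ (eucl_norm (y - x)%R)%:E).
  by rewrite lee_fin; have := coord_le_eucl_norm (y - x)%R i; rewrite !mxE.
by apply: ereal_sup_ubound; exists (y, x).
Qed.

Section localization.
Variables (F : set (set V)) (lam rho C : R).
Hypothesis mF : forall T, F T -> measurable (T : set Rn).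
Hypothesis F0 : forall T, F T -> T `<=` cube 0 1.
Hypothesis C0 : (0 <= C)%R.
Let Q : set V := cube 0 rho.
Let Q' : set V := cube 0 (rho + 1)%R.
Hypothesis Q0 : 0 < mu Q.

(* Apply the hypothesis around every point t and integrate over t. *)
Lemma halo_local : (forall O, open O -> O `<=` Q' ->
    mu (Q `&` halo F lam O) <= C%:E * mu O) ->
  forall O, open O -> mu (halo F lam O) <= (C * fine (mu Q') / fine (mu Q))%:E * mu O.
Proof.
move=> FC O oO; have oH : open (halo F lam O) by exact: open_halo.
have Qfin : mu Q \is a fin_num by rewrite ge0_fin_numE ?mu_ge0 ?mu_cube_lty.
have Q'fin : mu Q' \is a fin_num by rewrite ge0_fin_numE ?mu_ge0 ?mu_cube_lty.
(* The sets of F lie in [cube 0 1], so the points of t + Q only see the part of O in t + Q'. *)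
have loc (t : V) : mu (halo F lam O `&` translate t Q) <= C%:E * mu (O `&` translate t Q').
  rewrite -(mu_translate (- t)%R (_ `&` translate t Q)) translateI.
  rewrite translateD addNr translate0 translate_halo.
  rewrite -(mu_translate (- t)%R (_ `&` translate t Q')) translateI.
  rewrite translateD addNr translate0 (setIC (halo _ _ _)).
  apply: le_trans (FC _ _ _); last 2 first.
  - by apply: openI; [exact: open_translate|exact: open_cube].
  - by move=> x [].
  apply: le_mu => x [Qx [T FT lT]]; split => //; exists T => //.
  apply: lt_le_trans lT _; apply: le_mu => y [xTy Oy]; split => //; split => //.
  apply: cube_trans Qx _ => i; have /translateP/(F0 FT)/(_ i) := xTy.
  by rewrite !mxE subr0.
have key : mu (halo F lam O) * mu Q <= C%:E * (mu O * mu Q').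
  have mOQ (A : set Rn) r : open A -> measurable_fun [set: Rn]
      (fun t : Rn => mu (A `&` translate t (cube 0 r))).
    move=> oA; apply: measurable_mu_translateI; first exact: open_cube.
    exact: open_measurable_rV.
  have mO A : open A -> measurable (A : set Rn) by exact: open_measurable_rV.
  rewrite -!integral_mu_translateI//; [|exact: open_cube|exact: mO|exact: open_cube|exact: mO].
  have C0' : 0 <= C%:E by rewrite lee_fin.
  rewrite -(ge0_integralZl mu measurableT (mOQ O _ oO) (fun t _ => mu_ge0 _) C0').
  apply: ge0_le_integral.
  - exact: measurableT.
  - by move=> t _; exact: mu_ge0.
  - exact: mOQ.
  - by apply: measurable_funeM; exact: mOQ.
  - by move=> t _; exact: loc.
have q0 : (0 < fine (mu Q))%R by rewrite fine_gt0// Q0 ltey_eq Qfin.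
rewrite -(@lee_pmul2r _ (mu Q))//; apply: le_trans key _.
rewrite -[in leRHS](fineK Qfin) muleAC -EFinM divfK ?gt_eqF//.
by rewrite EFinM fineK// -muleA (muleC (mu O)).
Qed.

End localization.
End halo.

(** * Filling half of a cube with translates *)

Section packing.
Context {R : realType} {n : nat}.
Local Notation V := 'rV[R]_n.
Local Notation Rn := (measurable_rV R n).
Local Notation mu := (@lebesgue_rV R n).
Local Open Scope ereal_scope.

Definition translates (s : seq V) (A : set V) : set V :=
  [set x | exists2 t, t \in s & translate t A x].

Lemma translates_cons t s A : translates (t :: s) A = translate t A `|` translates s A.
Proof.
apply/seteqP; split => x.
  by move=> [u]; rewrite inE => /orP[/eqP->|us]; [left|right; exists u].
by move=> [tA|[u us uA]]; [exists t; rewrite ?mem_head|exists u => //; rewrite inE us orbT].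
Qed.

Lemma open_translates s A : open A -> open (translates s A).
Proof.
move=> oA; elim: s => [|t s IH].
  by rewrite (_ : translates _ _ = set0) ?open0//; apply/seteqP; split => // x [].
by rewrite translates_cons; apply: openU => //; exact: open_translate.
Qed.

Lemma mu_translates_le s A : mu (translates s A) <= (size s)%:R%:E * mu A.
Proof.
elim: s => [|t s IH].
  rewrite (_ : translates _ _ = set0) ?mul0e; last by apply/seteqP; split => // x [].
  by have := @lebesgue_outer0 R n; rewrite /lebesgue_rV => ->.
rewrite translates_cons; apply: le_trans (muU_le _ _) _.
rewrite mu_translate /= -natr1 EFinD ge0_muleDl ?lee_fin// mul1e addeC.
exact: leeD2r.
Qed.

Variable rho : R.
Let Q : set V := cube 0 rho.
Let W : set V := cube 0 (rho + rho)%R.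
Let q := fine (mu Q).
Let w := fine (mu W).
Hypothesis Q0 : 0 < mu Q.

Let QE : mu Q = q%:E.
Proof. by rewrite fineK// ge0_fin_numE ?mu_ge0 ?mu_cube_lty. Qed.

Let WE : mu W = w%:E.
Proof. by rewrite fineK// ge0_fin_numE ?mu_ge0 ?mu_cube_lty. Qed.

Let q0 : (0 < q)%R.
Proof. by move: Q0; rewrite QE lte_fin. Qed.

Hypothesis rho0 : (0 < rho)%R.

Let w0 : (0 < w)%R.
Proof.
rewrite -lte_fin -WE; apply: lt_le_trans Q0 _; apply: le_mu.
by apply: cube_le; rewrite lerDl ltW.
Qed.

(** If mu D >= q/2, the overlap of D with t + A averages at least (q/2)a/w over t in W; kappa a is
    half of this, which leaves room for a strict contradiction. W is Q - Q: for other t, t + A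
    misses Q. *)
Let kappa : R := (q / (4 * w))%R.

Let kappa0 : (0 < kappa)%R.
Proof. by rewrite divr_gt0// mulr_gt0. Qed.

(* The integral over t of mu (D `&` translate t A) is mu D * mu A, and only t in W
   contribute. *)
Lemma exists_translate (A : set V) (D : set Rn) (a : R) :
  open A -> A `<=` Q -> mu A = a%:E -> (0 < a)%R ->
  measurable D -> D `<=` Q -> (q / 2)%:E <= mu D ->
  exists2 t, W t & (kappa * a)%:E <= mu (D `&` translate t A).
Proof.
move=> oA AQ Aa a0 mD DQ qD; apply: contrapT => noT.
have mW : measurable (W : set Rn) by exact/open_measurable_rV/open_cube.
have small (t : V) : mu (D `&` translate t A) <= (kappa * a)%:E * (\1_W t)%:E.
  rewrite indicE; case: (pselect (W t)) => Wt.
    rewrite mem_set// mule1 leNgt; apply/negP => h; apply: noT; exists t => //.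
    exact: ltW.
  rewrite memNset// mule0 (_ : _ `&` _ = set0).
    by have := @lebesgue_outer0 R n; rewrite /lebesgue_rV => ->.
  apply/seteqP; split => // x [/DQ Qx /translateP/AQ Qxt]; apply: Wt => i.
  have := Qx i; have := Qxt i; rewrite !mxE !subr0 !ltr_norml => /andP[? ?] /andP[? ?].
  by apply/andP; split; lra.
have ka0 : (0 <= kappa * a)%R by rewrite mulr_ge0 ?ltW.
have m1 : measurable_fun [set: Rn] (fun t : Rn => (\1_(W : set Rn) t)%:E : \bar R).
  by apply/measurable_EFinP; exact: measurable_indic.
have : mu D * mu A <= (kappa * a)%:E * mu W.
  rewrite -integral_mu_translateI//.
  apply: (@le_trans _ _ (\int[mu]_(t in [set: Rn]) ((kappa * a)%:E * (\1_(W : set Rn) t)%:E))).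
    apply: ge0_le_integral.
    - exact: measurableT.
    - by move=> t _; exact: mu_ge0.
    - exact: measurable_mu_translateI.
    - exact: measurable_funeM.
    - by move=> t _; exact: small.
  have ka0' : 0 <= (kappa * a)%:E by rewrite lee_fin.
  rewrite (ge0_integralZl mu measurableT m1 _ ka0'); last by move=> t _; rewrite lee_fin.
  by rewrite integral_indic// setIT.
apply/negP; rewrite -ltNge Aa WE.
have : (q / 2)%:E * a%:E <= mu D * a%:E by rewrite lee_pmul2r// lte_fin.
apply: lt_le_trans; rewrite -!EFinM lte_fin /kappa.
have -> : (q / (4 * w) * a = q * a / 4 / w)%R by field; rewrite gt_eqF.
have qa0 : (0 < q * a)%R by rewrite mulr_gt0.
rewrite divfK ?gt_eqF//; lra.
Qed.

(** While less than half of Q is covered, the uncovered part has measure at least q/2, and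
    [exists_translate] covers a further kappa a of it. *)
Lemma greedy_translates (A : set V) (a : R) :
  open A -> A `<=` Q -> mu A = a%:E -> (0 < a)%R ->
  forall N, exists s, [/\ size s = N, forall t, t \in s -> W t &
    (Num.min (q / 2) (N%:R * (kappa * a)))%:E <= mu (Q `&` translates s A)].
Proof.
move=> oA AQ Aa a0; elim => [|N [s [sN sW sA]]].
  exists [::]; split => //; rewrite mul0r.
  apply: le_trans (mu_ge0 _); rewrite lee_fin ge_min; apply/orP; right.
  exact: lexx.
have oQ : measurable (Q : set Rn) by exact/open_measurable_rV/open_cube.
have oS : measurable (translates s A : set Rn) by exact/open_measurable_rV/open_translates.
have [qs|sq] := leP (q / 2)%:E (mu (Q `&` translates s A)).
  (* Half of Q is already covered: the translate by 0 only pads the list to the required length. *)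
  exists (0%R :: s); split.
  - by rewrite /= sN.
  - move=> t; rewrite inE => /orP[/eqP->|]; last exact: sW.
    by apply: cube_center; rewrite addr_gt0.
  - apply: (@le_trans _ _ (q / 2)%:E); first by rewrite lee_fin ge_min lexx.
    apply: le_trans qs _; apply: le_mu; apply: setIS; rewrite translates_cons.
    exact: subsetUr.
have Dsplit : mu Q = mu (Q `\` translates s A) + mu (Q `&` translates s A).
  exact: (measureDI mu oQ oS).
have [t Wt tA] : exists2 t, W t & (kappa * a)%:E <= mu ((Q `\` translates s A) `&` translate t A).
  apply: exists_translate => //; first exact: measurableD.
  have fin : mu (Q `&` translates s A) \is a fin_num.
    by rewrite ge0_fin_numE ?mu_ge0// (lt_trans sq) ?ltry.
  have fin' : mu (Q `\` translates s A) \is a fin_num.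
    rewrite ge0_fin_numE ?mu_ge0//; apply: le_lt_trans (mu_cube_lty 0 rho).
    by apply: le_mu => x [].
  move: Dsplit sq; rewrite QE -(fineK fin) -(fineK fin') -EFinD => -[qE].
  by rewrite lte_fin lee_fin; lra.
exists (t :: s); split.
- by rewrite /= sN.
- by move=> u; rewrite inE => /orP[/eqP->//|]; exact: sW.
rewrite (measureDI mu _ oS); last first.
  by apply: measurableI => //; apply/open_measurable_rV/open_translates.
apply: (@le_trans _ _ ((kappa * a)%:E + (Num.min (q / 2) (N%:R * (kappa * a)))%:E)).
  rewrite -EFinD lee_fin -[N.+1%:R]natr1 mulrDl mul1r.
  have : (0 < kappa * a)%R by rewrite mulr_gt0.
  move: (kappa * a)%R (N%:R * _)%R => k Nk k0.
  by have [h|h] := leP (q / 2)%R Nk; rewrite ge_min; apply/orP; [left|right]; lra.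
apply: leeD.
  apply: le_trans tA _; apply: le_mu => x [[Qx sx] tx]; split => //; split => //.
  by rewrite translates_cons; left.
apply: le_trans sA _; apply: le_mu => x [Qx sx]; split => //; split => //.
by rewrite translates_cons; right.
Qed.

(** Let a be the measure of the part of Q in the halo. About q/(2 kappa a) translates of that part
    fill half of Q. As mu O < a/C, N translates of O cost at most N a/C, and N a is bounded
    independently of O. Halos commute with translations, so the halo of the union is as large as
    wanted. *)
Lemma blow_up F lam C O : (forall T, F T -> measurable (T : set Rn)) ->
  (0 < C)%R -> open O -> O `<=` cube 0 (rho + 1)%R ->
  C%:E * mu O < mu (Q `&` halo F lam O) ->
  exists E, [/\ open E, E `<=` cube 0 (rho + rho + (rho + 1))%R,
    mu E <= ((2 * w + q) / C)%:E & (q / 2)%:E <= mu (Q `&` halo F lam E)].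
Proof.
move=> mF C0 oO OQ.
set A := Q `&` halo F lam O => CA.
have oA : open A by apply: openI; [exact: open_cube|exact: open_halo].
have AQ : A `<=` Q by move=> x [].
have Afin : mu A \is a fin_num.
  by rewrite ge0_fin_numE ?mu_ge0//; apply: le_lt_trans (mu_cube_lty 0 rho); exact: le_mu.
have Ofin : mu O \is a fin_num.
  rewrite ge0_fin_numE ?mu_ge0//; apply: le_lt_trans (mu_cube_lty 0 (rho + 1)%R).
  exact: le_mu.
pose a := fine (mu A); pose o := fine (mu O).
have Aa : mu A = a%:E by rewrite fineK.
have Oo : mu O = o%:E by rewrite fineK.
have o0 : (0 <= o)%R by rewrite -lee_fin -Oo mu_ge0.
move: CA; rewrite Aa Oo -EFinM lte_fin => oa.
have a0 : (0 < a)%R by apply: le_lt_trans oa; rewrite mulr_ge0// ltW.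
have ka0 : (0 < kappa * a)%R by rewrite mulr_gt0.
pose N := (Num.truncn (q / 2 / (kappa * a))).+1.
have [s [sN sW sA]] := greedy_translates oA AQ Aa a0 N.
have qN : (q / 2 <= N%:R * (kappa * a))%R.
  by rewrite -ler_pdivrMr// ltW// truncnS_gt.
have aq : (a <= q)%R by rewrite -lee_fin -Aa -QE; exact: le_mu.
(* Here q/2/kappa = 2w, and rounding up adds at most a <= q. *)
have Na : (N%:R * a <= 2 * w + q)%R.
  have : (N%:R <= q / 2 / (kappa * a) + 1)%R.
    rewrite /N -[_.+1%:R]natr1 lerD2r truncn_le// divr_ge0// ?ltW// divr_gt0//.
  rewrite -(ler_pM2r a0) mulrDl mul1r => /le_trans; apply.
  apply: lerD => //.
  have -> : (q / 2 / (kappa * a) * a = 2 * w)%R.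
    by rewrite /kappa; field; rewrite !gt_eqF.
  exact: lexx.
exists (translates s O); split.
- exact: open_translates.
- move=> x [t /sW Wt /translateP/OQ xt]; apply: (cube_trans Wt) => i.
  by have := xt i; rewrite !mxE subr0.
- apply: le_trans (mu_translates_le _ _) _; rewrite sN Oo -EFinM lee_fin.
  rewrite ler_pdivlMr//; apply: le_trans Na; rewrite -mulrA ler_pM2l ?ltr0n//.
  by rewrite mulrC ltW.
- apply: le_trans (_ : mu (Q `&` translates s A) <= _).
    by apply: le_trans sA; rewrite lee_fin le_min lexx qN.
  apply: le_mu => x [Qx [t st xA]]; split => //.
  apply: (@halo_subset _ _ F F lam (translate t O)) => //.
    by move=> y yO; exists t.
  rewrite -translate_halo; apply/translateP; have /translateP[] := xA.
  by [].
Qed.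

End packing.

(** * From the density property to a weak type inequality *)

Section density_weak_type.
Context {R : realType} {n : nat}.
Local Notation V := 'rV[R]_n.
Local Notation Rn := (measurable_rV R n).
Local Notation mu := (@lebesgue_rV R n).
Local Open Scope ereal_scope.
Variable B : diff_basis R n.

Lemma average_indic_gt (E S : set Rn) (c : R) : measurable E -> measurable S ->
  0 < mu S -> mu S < +oo ->
  (c%:E < average \1_E S) = (c%:E * mu S < mu (S `&` E)).
Proof.
by move=> mE mS S0 Soo; rewrite lt_average// integral_indic// setIC.
Qed.

Lemma average_indic_lt (E S : set Rn) (c : R) : measurable E -> measurable S ->
  0 < mu S -> mu S < +oo ->
  (average \1_E S < c%:E) = (mu (S `&` E) < c%:E * mu S).
Proof.
by move=> mE mS S0 Soo; rewrite average_lt// integral_indic// setIC.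
Qed.

Lemma basis_lt_measurable x (r : \bar R) S : basis_lt B x r S -> measurable S.
Proof. by move=> [/basis_atP[]]. Qed.

Lemma basis_lt_subset x (r s : \bar R) : r <= s -> basis_lt B x r `<=` basis_lt B x s.
Proof. by move=> rs S [BS Sr]; split => //; exact: lt_le_trans rs. Qed.

(** Positivity is inherited from a basis set, which is bounded and of positive measure. *)
Lemma exists_cube_mu_gt0 : exists2 rho : R, (0 < rho)%R & 0 < mu (cube 0 rho).
Proof.
have [T_ BT _] := basis_at_shrink B 0%R.
have [bT mT T0 _] := basis_atP (BT 0%N).
have [rho rho0 Trho] := bounded_cube bT.
by exists rho => //; apply: lt_le_trans T0 _; exact: le_mu.
Qed.

Hypothesis tB : translation_invariant B.

Lemma upper_derivative_ge (E : set Rn) (lam : R) (x : Rn) : measurable E ->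
  (forall k, halo (basis_lt B 0%R (k.+1%:R^-1)%R%:E) lam E x) ->
  lam%:E <= upper_derivative B \1_E x.
Proof.
move=> mE xE; apply: le_ereal_inf_tmp => _ [e /= e0 <-].
have [k] := @ltr_add_invr R 0 e e0; rewrite add0r => ke.
have [T FT lT] := xE k.
have xT : basis_lt B x e%:E (translate x T).
  apply/(basis_lt_translate _ _ _ tB); exists T => //.
  by apply: basis_lt_subset FT; rewrite lee_fin ltW.
have [BxT _] := xT; have [_ mT T0 _] := basis_atP BxT.
apply: (@le_trans _ _ (average \1_E (translate x T))).
  by apply/ltW; rewrite average_indic_gt//; [rewrite mu_translate|exact: basis_mu_lty BxT].
by apply: ereal_sup_ubound; exists (translate x T).
Qed.

(** Condensation of singularities: failures at the scales 1/(k+1), with geometrically growing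
    constants [C k], are gathered into one set. The density property concerns bounded sets, so
    [halo_local] first confines the failures to a fixed cube. *)
Lemma density_halo (lam : R) : density_basis B -> (0 < lam)%R ->
  exists C r : R, [/\ (0 < C)%R, (0 < r)%R & forall O : set V, open O ->
    mu (halo (basis_lt B 0%R r%:E) lam O) <= C%:E * mu O].
Proof.
move=> dB lam0; apply: contrapT => noC.
have [rho rho0 Q0] := exists_cube_mu_gt0.
pose Q : set V := cube 0 rho.
pose q := fine (mu Q); pose w := fine (mu (cube 0 (rho + rho)%R)).
have QE : mu Q = q%:E by rewrite fineK// ge0_fin_numE ?mu_ge0 ?mu_cube_lty.
have q0 : (0 < q)%R by move: Q0; rewrite -/Q QE lte_fin.
have w0 : (0 <= w)%R by apply: fine_ge0; exact: mu_ge0.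
pose F k : set (set V) := basis_lt B 0%R (k.+1%:R^-1)%R%:E.
have mF k T : F k T -> measurable (T : set Rn) by exact: basis_lt_measurable.
have k1 k : (0 < k.+1%:R^-1 :> R)%R by rewrite invr_gt0.
have F0 k T : F k T -> T `<=` cube 0 1.
  move=> [BT Tk]; have [_ _ _ T0] := basis_atP BT.
  move=> x Tx; apply: (cube_le (r := (k.+1%:R^-1)%R)).
    by rewrite invf_le1// ler1n.
  exact: diam_lt_cube Tk T0 Tx.
(* Chosen so that the bound (2w + q) / C k of [blow_up] is q/4/2^(k+1), with sum q/4. *)
pose C k : R := ((2 * w + q) / (q / 4 / (2 ^ k.+1)%:R))%R.
have p0 k : (0 < q / 4 / (2 ^ k.+1)%:R)%R.
  by rewrite !divr_gt0// ltr0n expn_gt0.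
have C0 k : (0 < C k)%R by rewrite divr_gt0// ltr_wpDl// mulr_ge0.
have /choice[E EP] : forall k, exists E, [/\ open E,
    E `<=` cube 0 (rho + rho + (rho + 1))%R,
    mu E <= (q / 4 / (2 ^ k.+1)%:R)%:E &
    (q / 2)%:E <= mu (Q `&` halo (F k) lam E)].
  move=> k; have [ O [oO OQ CO]] : exists O : set V, [/\ open O,
      O `<=` cube 0 (rho + 1)%R & (C k)%:E * mu O < mu (Q `&` halo (F k) lam O)].
    apply: contrapT => noO; apply: noC.
    exists (C k * fine (mu (cube (0 : V) (rho + 1))) / q)%R, (k.+1%:R^-1)%R; split => //.
      rewrite divr_gt0// mulr_gt0// fine_gt0// mu_cube_lty andbT.
      by apply: lt_le_trans Q0 _; apply/le_mu/cube_le; rewrite lerDl.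
    apply: (halo_local (mF k) (F0 k) (ltW (C0 k)) Q0) => O oO OQ.
    by rewrite leNgt; apply/negP => h; apply: noO; exists O.
  have [E [oE EQ' ECk qE]] := blow_up Q0 rho0 (mF k) (C0 k) oO OQ CO.
  exists E; split => //; apply: le_trans ECk _; rewrite lee_fin -/w -/q /C.
  by rewrite invf_div mulrCA mulfV ?mulr1// gt_eqF// ltr_wpDl// mulr_ge0.
pose U := \bigcup_k E k.
have oU : open U by apply: bigcup_open => k _; have [] := EP k.
have mU : measurable (U : set Rn) by exact: open_measurable_rV.
have bU : bounded_set U.
  by apply: (@cube_bounded _ _ _ (rho + rho + (rho + 1))%R) => x [k _]; have [_ + _ _] := EP k; apply.
have Uq : mu U <= (q / 4)%:E.
  apply: le_trans (mu_bigcup_le E) _.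
  apply: le_trans (epsilon_trick0 xpredT _); last by rewrite divr_ge0// ltW.
  apply: lee_nneseries => [k _ _|k _]; first exact: mu_ge0.
  by have [_ _ ? _] := EP k.
(* Each halo fills q/2 of Q and U has measure at most q/4, so q/4 is left outside U. These
   remainders decrease with k; on their intersection, still of measure at least q/4, \1_U is 0 while
   its upper derivative is at least lam. *)
pose G k := (Q `&` halo (F k) lam U) `\` U.
have mQ : measurable (Q : set Rn) by exact/open_measurable_rV/open_cube.
have mH k : measurable (Q `&` halo (F k) lam U : set Rn).
  apply: measurableI => //; apply/open_measurable_rV/open_halo => //.
  exact: mF.
have mG k : measurable (G k : set Rn) by exact: measurableD.
have Ufin : mu U \is a fin_num by rewrite ge0_fin_numE ?mu_ge0// (le_lt_trans Uq)// ltry.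
have Gq k : (q / 4)%:E <= mu (G k).
  have : (q / 2)%:E <= mu (G k) + mu U.
    apply: (@le_trans _ _ (mu (Q `&` halo (F k) lam U))).
      have [_ _ _ /le_trans] := EP k; apply; apply: le_mu; apply: setIS.
      by apply: halo_subset => // x Ex; exists k.
    apply: le_trans (muU_le _ _); apply: le_mu => x Hx.
    by case: (pselect (U x)); [right|left].
  move=> /le_trans/(_ (leeD2l _ Uq)); rewrite -leeBlDr// -EFinB.
  by apply: le_trans; rewrite lee_fin; lra.
have mIG : measurable (\bigcap_k (G k : set Rn)) by exact: bigcapT_measurable.
have ndG : nonincreasing_seq (fun k => G k : set Rn).
  apply/nonincreasing_seqP => k; apply/subsetPset => x [[Qx Hx] Ux]; split => //; split => //.
  apply: halo_subset Hx => //; apply: basis_lt_subset.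
  by rewrite lee_fin lef_pV2 ?posrE// ler_nat.
have G0 : mu (G 0%N) < +oo.
  by apply: le_lt_trans (mu_cube_lty 0 rho); apply: le_mu => x [[]].
have cvgG := nonincreasing_cvg_mu (mu := mu) G0 mG mIG ndG.
have : (q / 4)%:E <= mu (\bigcap_k G k).
  move/cvg_lim : (cvgG) => <- //; apply: lime_ge.
    by apply/cvg_ex; exists (mu (\bigcap_k G k)).
  by apply: nearW => k; exact: Gq.
apply/negP; rewrite -ltNge.
have [N [mN N0 NP]] := dB U mU bU.
apply: (@le_lt_trans _ _ (mu N)); last by rewrite N0 lte_fin divr_gt0.
apply: le_mu => x Gx; apply: NP => /= -[upx _].
have [[_ _] nUx] := Gx 0%N I.
have : lam%:E <= upper_derivative B \1_U x.
  by apply: upper_derivative_ge => // k; have [[_]] := Gx k I.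
by rewrite upx indicE memNset// lee_fin leNgt lam0.
Qed.

End density_weak_type.

(** * Convex sets between two parallelepipeds *)

Section convex_sandwich.
Context {R : realType} {n : nat}.
Local Notation V := 'rV[R]_n.
Local Notation Rn := (measurable_rV R n).
Local Notation mu := (@lebesgue_rV R n).

(* Infinitely many pairwise disjoint translates of T fit in a bounded set. *)
Lemma mu_hyperplane (T : set Rn) (w : 'cV[R]_n) : measurable T ->
  bounded_set (T : set V) -> w != 0 ->
  (forall y : V, T y -> y *m w = 0) -> mu T = 0%E.
Proof.
move=> mT /bounded_cube[M M0 TM] w0 Tw.
have [i wi] : exists i, w i ord0 != 0.
  by apply/existsP; apply: contra_neqT w0 => /existsPn w0; apply/colP => i;
    rewrite !mxE; apply/eqP; have := w0 i; rewrite negbK.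
(* The translates by [v k] lie in distinct parallel hyperplanes, as [v k *m w] is w_i/(k+1), and all
   stay in a cube enlarged by 1. *)
pose v k : V := k.+1%:R^-1 *: delta_mx 0 i.
have vw k : v k *m w = (k.+1%:R^-1 * w i ord0)%:M.
  apply/matrixP => a b; rewrite !ord1 -scalemxAl -rowE !mxE eqxx mulr1n.
  by [].
have mTk k : measurable (translate (v k) T : set Rn) by exact: measurable_translate.
have tT : trivIset setT (fun k => translate (v k) T).
  apply/trivIsetP => j k _ _ jk; apply/seteqP; split => // x [/translateP xj /translateP xk].
  have := Tw _ xj; have := Tw _ xk; rewrite !mulmxBl !vw => /eqP.
  rewrite subr_eq0 => /eqP -> /eqP; rewrite subr_eq0 => /eqP /(congr1 (fun A : 'M[R]_1 => A ord0 ord0)).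
  rewrite !mxE !eqxx !mulr1n => /(mulIf wi)/invr_inj/eqP; rewrite eqr_nat eqSS.
  by rewrite eq_sym (negbTE jk).
have Tle N : ((N%:R)%:E * mu T <= mu (cube (0 : V) (M + 1)%R))%E.
  have <- : mu (\big[setU/set0]_(k < N) translate (v k) T) = (N%:R%:E * mu T)%E.
    transitivity (\sum_(k < N) mu (translate (v k) T))%E.
      exact: (measure_bigsetU mu mTk tT).
    rewrite (eq_bigr (fun=> mu T)); last by move=> k _; rewrite mu_translate.
    elim: N => [|N IH]; first by rewrite big_ord0 mul0e.
    by rewrite big_ord_recr /= IH -[N.+1%:R]natr1 EFinD ge0_muleDl ?lee_fin// mul1e.
  apply: le_mu; rewrite -(bigcup_mkord N (fun k => translate (v k) T)) => x [k _ /translateP/TM xk] l.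
  have : 0 <= v k ord0 l <= 1.
    rewrite !mxE eqxx/=; case: (l == i); rewrite ?mulr0 ?mulr1 ?lexx ?ler01//.
    by rewrite invr_ge0 ler0n invf_le1// ler1n.
  move: xk; move: (v k) => u /(_ l) + /andP[? ?].
  rewrite !mxE !subr0 !ltr_norml => /andP[? ?]; apply/andP; split; lra.
have Tfin : mu T \is a fin_num.
  by rewrite ge0_fin_numE ?mu_ge0//; apply: le_lt_trans (mu_cube_lty 0 M); exact: le_mu.
have Kfin : mu (cube (0 : V) (M + 1)) \is a fin_num.
  by rewrite ge0_fin_numE ?mu_ge0// mu_cube_lty.
move: Tle; rewrite -(fineK Tfin) -(fineK Kfin); set t := fine _; set K := fine _ => Tle.
have t0 : 0 <= t by apply: fine_ge0; exact: mu_ge0.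
congr EFin; apply/eqP; rewrite eq_le t0 andbT leNgt; apply/negP => tp.
have := Tle (Num.truncn (K / t)).+1; rewrite -EFinM lee_fin leNgt.
by rewrite -ltr_pdivrMr// truncnS_gt.
Qed.

(** Take rows in T of maximal rank. By maximality T lies in their row space, so every column of the
    cokernel annihilates T and must vanish. *)
Lemma exists_unit_rows (T : set V) :
  (forall w : 'cV[R]_n, (forall y : V, T y -> y *m w = 0) -> w = 0) ->
  exists2 X : 'M[R]_n, X \in unitmx & forall i, T (row i X).
Proof.
move=> Tw.
pose P r := `[< exists m (X : 'M[R]_(m, n)), (forall i, T (row i X)) /\ \rank X = r >].
have exP : exists r, P r.
  exists 0%N; apply/asboolP; exists 0%N, 0; split; last by rewrite mxrank0.
  by case.
have Ple r : P r -> (r <= n)%N.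
  by move=> /asboolP[m [X [_ <-]]]; exact: rank_leq_col.
case: (ex_maxnP exP Ple) => r /asboolP[m [X [TX rX]]] rmax.
have TX0 : row_full X.
  rewrite -cokermx_eq0; apply/eqP/matrixP => i j.
  rewrite [RHS]mxE.
  pose w : 'cV[R]_n := col j (cokermx X).
  suff w0 : w = 0 by have := congr1 (fun w : 'cV[R]_n => w i ord0) w0; rewrite !mxE.
  apply: Tw => y Ty.
  have yX : (y <= X)%MS.
    have := mxrank_leqif_sup (_ : X <= col_mx X y)%MS.
    rewrite col_mx_sub submx_refl /= => <-.
      rewrite eqn_leq mxrankS /= ?rX; last by have := submx_refl (col_mx X y); rewrite col_mx_sub => /andP[].
      apply: rmax; apply/asboolP; exists (m + 1)%N, (col_mx X y); split => // k.
      by case: (split_ordP k) => l ->; rewrite ?rowKu ?rowKd// ord1 row_id.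
    by have := submx_refl (col_mx X y); rewrite col_mx_sub => /andP[].
  by rewrite /w colE mulmxA; move: yX; rewrite submxE => /eqP ->; rewrite mul0mx.
exists (rowsub (fullrankfun TX0) X); first exact: fullrowsub_unit.
by move=> i; rewrite row_rowsub.
Qed.

Definition set_row (i : 'I_n) (y : V) (X : 'M[R]_n) : 'M[R]_n :=
  \matrix_(k, l) if k == i then y ord0 l else X k l.

(** Expansion along row i, whose cofactors ignore the replaced row. Divided by [\det X], this is
    Cramer's rule for the coordinates of y in the rows of X. *)
Lemma det_set_row (i : 'I_n) (y : V) (X : 'M[R]_n) :
  \det (set_row i y X) = (y *m \adj X) ord0 i.
Proof.
rewrite (expand_det_row _ i) mxE; apply: eq_bigr => j _.
rewrite !mxE eqxx /cofactor; congr (_ * (_ * \det _)).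
by apply/matrixP => k l; rewrite !mxE eq_sym (negbTE (neq_lift _ _)).
Qed.

Lemma det_bounded (M : R) (X : 'M[R]_n) : (forall i j, `|X i j| <= M) ->
  `|\det X| <= \sum_(s : 'S_n) M ^+ n.
Proof.
move=> XM; apply: le_trans (ler_norm_sum _ _ _) _; apply: ler_sum => s _.
rewrite normrM normrX normrN1 expr1n mul1r normr_prod -[X in M ^+ X]card_ord -prodr_const.
by apply: ler_prod => i _; rewrite normr_ge0 XM.
Qed.

(* Choose the rows in T so that |det| is more than half of its supremum, and bound
   the coordinates by Cramer's rule. *)
Lemma exists_dominating_rows (T : set V) : bounded_set T ->
  (forall w : 'cV[R]_n, (forall y : V, T y -> y *m w = 0) -> w = 0) ->
  exists X : 'M[R]_n, [/\ X \in unitmx, forall i, T (row i X) &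
    forall y, T y -> forall i, `|(y *m invmx X) ord0 i| <= 2].
Proof.
move=> /bounded_cube[M M0 TM] /exists_unit_rows[X0 X0u X0T].
pose D := [set d | exists2 X : 'M[R]_n, forall i, T (row i X) & d = `|\det X|].
have rowM (X : 'M[R]_n) : (forall i, T (row i X)) -> forall i j, `|X i j| <= M.
  by move=> XT i j; have := TM _ (XT i) j; rewrite !mxE subr0 => /ltW.
have supD : has_sup D.
  split; first by exists `|\det X0|, X0.
  by exists (\sum_(s : 'S_n) M ^+ n) => _ [X /rowM XM ->]; exact: det_bounded.
have Dle (X : 'M[R]_n) : (forall i, T (row i X)) -> `|\det X| <= sup D.
  by move=> XT; apply: sup_upper_bound => //; exists X.
have supD0 : 0 < sup D.
  apply: lt_le_trans (Dle _ X0T); rewrite normr_gt0.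
  by move: X0u; rewrite unitmxE unitfE.
(* T need not be closed, so the supremum may not be attained; settling for half of it gives the
   bound 2 instead of 1. *)
have supD20 : 0 < sup D / 2 by rewrite divr_gt0.
have [_ [X XT ->] DX] := sup_adherent supD20 supD.
have detX : sup D / 2 < `|\det X| by lra.
have X0' : \det X != 0 by rewrite -normr_gt0 (lt_trans supD20).
have Xu : X \in unitmx by rewrite unitmxE unitfE.
exists X; split => // y Ty i.
rewrite /invmx Xu -scalemxAr mxE -det_set_row normrM normfV.
rewrite ler_pdivrMl ?normr_gt0//; apply: (@le_trans _ _ (sup D)); last by lra.
apply: Dle => k; rewrite (_ : row k _ = if k == i then y else row k X).
  by case: ifP.
by apply/rowP => l; rewrite !mxE; case: ifP => //; rewrite mxE.
Qed.

Lemma convex_rV (T : set V) : convex_set (T : set (convex_lmodType V)) ->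
  forall x y (t : R), T x -> T y -> 0 <= t <= 1 -> T (t *: x + (1 - t) *: y).
Proof.
move=> cT x y t Tx Ty /andP[t0 t1].
by have := cT x y (Itv01 t0 t1); rewrite !inE; apply.
Qed.

Lemma convex_average (T : set V) (I : eqType) (r : seq I) (x : I -> V) :
  convex_set (T : set (convex_lmodType V)) -> (forall i, T (x i)) ->
  r != [::] -> T ((size r)%:R^-1 *: \sum_(i <- r) x i).
Proof.
move=> cT Tx; elim: r => // i [|j r] IH _.
  by rewrite big_seq1 /= invr1 scale1r.
have s0 : (size r).+1%:R + 1 != 0 :> R by rewrite natr1 pnatr_eq0.
rewrite big_cons scalerDr [size _]/= -[(size r).+2%:R]natr1; move: IH => /=.
set s : R := (size r).+1%:R in s0 * => IH.
have s1 : s != 0 by rewrite pnatr_eq0.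
have sp : 0 < s by rewrite ltr0n.
have := convex_rV cT (Tx i) (IH isT) (t := (s + 1)^-1).
rewrite scalerA -/s (_ : (1 - (s + 1)^-1) * s^-1 = (s + 1)^-1).
  apply; rewrite invr_ge0 ltW/= ?addr_gt0// invf_le1 ?addr_gt0//.
  by rewrite lerDr ltW.
have key (u : R) : u != 0 -> u + 1 != 0 -> (1 - (u + 1)^-1) * u^-1 = (u + 1)^-1.
  by move=> ? ?; field; apply/andP.
exact: key.
Qed.

(** The rows are divided by n to make the inner cell fit: a times X/n is the average of the n points
    a_i row_i X, each on the segment from 0 to a row in T. Coordinates bounded by 2 thereby become
    bounded by 2n. *)
Lemma convex_sandwich (T : set Rn) : (0 < n)%N -> measurable T ->
  bounded_set (T : set V) -> convex_set (T : set (convex_lmodType V)) ->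
  T 0 -> (0 < mu T)%E ->
  exists X : 'M[R]_n, [/\ X \in unitmx,
    forall a : V, (forall i, 0 <= a ord0 i <= 1) -> T (a *m X) &
    forall y, T y -> exists2 a : V, y = a *m X &
      forall i, `|a ord0 i| <= 2 * n%:R].
Proof.
move=> n0 mT bT cT T0 muT.
have [|X [Xu XT TX]] := exists_dominating_rows bT.
  move=> w Tw; apply: contraPeq muT => w0.
  by rewrite (mu_hyperplane mT bT w0 Tw) ltxx.
have n0' : n%:R != 0 :> R by rewrite pnatr_eq0 -lt0n.
exists (n%:R^-1 *: X); split.
- by rewrite unitmxZ// unitfE invr_eq0.
- move=> a a01.
  have -> : a *m (n%:R^-1 *: X) = (size (enum 'I_n))%:R^-1 *:
      \sum_(i <- enum 'I_n) a ord0 i *: row i X.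
    by rewrite -scalemxAr mulmx_sum_row size_enum_ord big_enum.
  apply: convex_average => //.
    move=> i; have := convex_rV cT (XT i) T0 (a01 i).
    by rewrite scaler0 addr0.
  by rewrite -size_eq0 size_enum_ord -lt0n.
- move=> y Ty; exists (n%:R *: (y *m invmx X)).
    by rewrite -scalemxAl -scalemxAr scalerA mulfV// scale1r mulmxKV.
  move=> i; rewrite mxE normrM (ger0_norm (ler0n _ n)) mulrC.
  by apply: ler_wpM2r => //; exact: TX.
Qed.

End convex_sandwich.

Lemma ge0_integral_bigsetU_le d (T : measurableType d) (R : realType)
    (nu : {measure set T -> \bar R}) (I : eqType) (r : seq I) (A : I -> set T)
    (g : T -> \bar R) :
  measurable_fun [set: T] g -> (forall x, 0 <= g x)%E -> (forall i, measurable (A i)) ->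
  (\int[nu]_(x in \big[setU/set0]_(i <- r) A i) g x <= \sum_(i <- r) \int[nu]_(x in A i) g x)%E.
Proof.
move=> mg g0 mA; elim: r => [|i r IH]; first by rewrite !big_nil integral_set0.
rewrite !big_cons.
have mU : measurable (\big[setU/set0]_(i <- r) A i) by exact: bigsetU_measurable.
have -> : A i `|` \big[setU/set0]_(i <- r) A i =
    A i `|` (\big[setU/set0]_(i <- r) A i `\` A i).
  apply/seteqP; split => x; last by case=> [|[]]; [left|right].
  by case: (pselect (A i x)) => [|? []//]; [left|right].
have mD : measurable (\big[setU/set0]_(i <- r) A i `\` A i) by exact: measurableD.
rewrite ge0_integral_setU//; last 2 first.
- exact: measurable_funTS.
- by rewrite disj_set2E; apply/eqP/seteqP; split => // x [? [_ ?]].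
apply: leeD2l; apply: le_trans IH; apply: ge0_subset_integral => //.
exact: measurable_funTS.
Qed.

(** * Parallelepipeds and their enlargement by halos *)

Section parallelepipeds.
Context {R : realType} {n : nat}.
Local Notation V := 'rV[R]_n.
Local Notation Rn := (measurable_rV R n).
Local Notation mu := (@lebesgue_rV R n).
Variable X : 'M[R]_n.
Hypothesis Xu : X \in unitmx.

Definition pset (p : V) (lo hi : R) : set V :=
  [set p + u *m X | u in [set u : V | forall i, lo <= u ord0 i <= hi]].

Lemma pset_affine p lo hi s (w : V) : 0 < s ->
  [set s *: y + (p + w *m X) | y in pset 0 lo hi] =
  [set p + u *m X | u in [set u : V | forall i, s * lo + w ord0 i <= u ord0 i <= s * hi + w ord0 i]].
Proof.
move=> s0; apply/seteqP; split => [_ [_ [u uI <-] <-]|_ [u uI <-]].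
  exists (s *: u + w).
    by move=> i; have /andP[? ?] := uI i; rewrite !mxE !lerD2r !ler_pM2l//; apply/andP.
  by rewrite add0r mulmxDl -scalemxAl addrCA.
exists (0 + (s^-1 *: (u - w)) *m X).
  exists (s^-1 *: (u - w)) => // i; have /andP[? ?] := uI i; rewrite !mxE.
  by apply/andP; split; rewrite mulrC ?ler_pdivlMr ?ler_pdivrMr//; lra.
by rewrite add0r -scalemxAl scalerA mulfV ?gt_eqF// scale1r addrCA -mulmxDl subrK.
Qed.

(** All coordinates range over the same interval, so a dilation and a translation relate the two
    sets. The measure of X[0,1]^n stays an unknown factor, which avoids the change of variables
    formula for X. *)
Lemma mu_pset p lo hi : lo < hi ->
  mu (pset p lo hi) = (((hi - lo) ^+ n)%:E * mu (pset 0 0 1%R))%E.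
Proof.
move=> lh; have s0 : 0 < hi - lo by rewrite subr_gt0.
rewrite -[in RHS](gtr0_norm s0) -(mu_affine (p + const_mx lo *m X)) ?gt_eqF//.
rewrite pset_affine// /pset; congr (mu (image _ _)); apply/funext => u/=.
by apply/propext; split => uI i; have := uI i; rewrite mxE mulr0 add0r mulr1 subrK.
Qed.

Lemma measurable_pset p lo hi : measurable (pset p lo hi : set Rn).
Proof.
rewrite (_ : pset _ _ _ = translate p ((fun y : Rn => (y : V) *m invmx X) @^-1`
    box (const_mx lo) (const_mx hi))).
  apply/measurable_translate/measurable_box_preimage => i.
  under eq_fun do rewrite mxE.
  apply: measurable_sum => j; apply: measurable_funM; last exact: measurable_cst.
  exact: measurable_coord.
apply/seteqP; split => [_ [u uI <-]|y /translateP yI].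
  by apply/translateP => i /=; rewrite addrC addKr mulmxK// !mxE.
exists ((y - p) *m invmx X); last by rewrite mulmxKV// addrC subrK.
by move=> i; have := yI i; rewrite /= ![const_mx _ _ _]mxE.
Qed.

(** In units of the measure of X[0,1]^n, T has at most (2m)^n and a cell of side 1/4 has 4^-n: the
    ratio is at least (8m)^-n. The factor 1/2 gives the strict inequality that [halo] asks for. *)
Lemma mu_lt_pset (T : set Rn) (m : R) : 0 < m ->
  (forall a : V, (forall i, 0 <= a ord0 i <= 1) -> T (a *m X)) ->
  T `<=` pset 0 (- m) m -> (0 < mu T)%E -> (mu T < +oo)%E ->
  ((((8 * m) ^+ n)^-1 / 2)%:E * mu T < mu (pset 0 0 4^-1))%E.
Proof.
move=> m0 T01 Tm T0 Too.
have m2 : - m < m by rewrite gtrN.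
have TT : (mu T <= ((m - - m) ^+ n)%:E * mu (pset 0 0 1%R))%E.
  by rewrite -(mu_pset 0 m2); exact: le_mu.
have kT : (mu (pset 0 0 1%R) <= mu T)%E.
  by apply: le_mu => _ [u uI <-]; rewrite add0r; exact: T01.
have kfin : mu (pset 0 0 1%R) \is a fin_num.
  by rewrite ge0_fin_numE ?mu_ge0//; exact: le_lt_trans Too.
rewrite (@mu_pset _ 0 4^-1) ?invr_gt0// subr0.
set lam := (X in (X%:E * mu T < _)%E).
have lam0 : 0 < lam by rewrite divr_gt0// invr_gt0 exprn_gt0// mulr_gt0.
have lT : (lam%:E * mu T <= lam%:E * (((m - - m) ^+ n)%:E * mu (pset 0 0 1%R)))%E.
  by rewrite lee_pmul2l.
apply: le_lt_trans lT _; move: T0 TT; rewrite -(fineK kfin).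
set k := fine _ => T0' TT.
have k0 : 0 < k.
  have := lt_le_trans T0' TT; rewrite -EFinM lte_fin pmulr_rgt0//.
  by rewrite exprn_gt0// opprK addr_gt0.
rewrite -!EFinM lte_fin mulrA ltr_pM2r// /lam.
have -> : m - - m = 2 * m by ring.
have -> : 8 * m = 4 * (2 * m) by ring.
have m2' : 0 < (2 * m) ^+ n by rewrite exprn_gt0// mulr_gt0.
have p4 : 0 < 4 ^+ n :> R by rewrite exprn_gt0.
rewrite [X in X^-1]exprMn exprVn.
have -> : (4 ^+ n * (2 * m) ^+ n)^-1 / 2 * (2 * m) ^+ n = (4 ^+ n)^-1 / 2.
  by field; rewrite !gt_eqF.
by rewrite ltr_pdivrMr// ltr_pMr ?invr_gt0// ltr1n.
Qed.

Section steps.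
Variables (T : set Rn) (lam : R).
Hypothesis T01 : forall a : V, (forall i, 0 <= a ord0 i <= 1) -> T (a *m X).
Hypothesis small : (lam%:E * mu T < mu (pset 0 0 4^-1))%E.

(** In coordinates, the translate of T at a covers a + [0,1]^n; the cell of side 1/4 with lower
    corner w = max(lo, a) lies both there and in [lo,hi]^n. This gains 1 - 1/4 below and loses 1/4
    above. *)
Lemma halo_step_forward (F : set (set V)) p lo hi (A : set V) : F T ->
  lo + 4^-1 <= hi -> pset p lo hi `<=` A ->
  pset p (lo - 3 / 4) (hi - 4^-1) `<=` halo F lam A.
Proof.
move=> FT lh pA _ [a aI <-]; exists T => //; apply: lt_le_trans small _.
pose w : V := \row_i Num.max lo (a ord0 i).
have q4 : 0 < 4^-1 :> R by rewrite invr_gt0.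
rewrite -(mu_translate (p + w *m X)); apply: le_mu => z /translateP[u uI].
rewrite add0r => zE.
have {}zE : z = p + (w + u) *m X by rewrite mulmxDl addrA zE addrC subrK.
have wI i : lo <= w ord0 i /\ a ord0 i <= w ord0 i /\ w ord0 i <= hi - 4^-1 /\
    w ord0 i <= a ord0 i + 3 / 4.
  have /andP[? ?] := aI i; rewrite mxE !le_max lexx; split => //; split; first by rewrite lexx orbT.
  by rewrite !ge_max; split; apply/andP; split; lra.
split; last first.
  apply: pA; exists (w + u) => // i; have [? [? [? ?]]] := wI i; have /andP[? ?] := uI i.
  by rewrite mxE; apply/andP; split; lra.
apply/translateP; rewrite zE opprD addrACA subrr add0r -mulmxBl; apply: T01 => i.
have [? [? [? ?]]] := wI i; have /andP[? ?] := uI i.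
by rewrite mxE [(w + u) _ _]mxE [(- a) _ _]mxE; apply/andP; split; lra.
Qed.

(** Now -T covers a + [-1,0]^n, and the cell ends at min(hi, a). The gain is above; the two steps
    together gain 3/4 - 1/4 = 1/2 on each side. *)
Lemma halo_step_backward (F : set (set V)) p lo hi (A : set V) : F (reflect T) ->
  lo + 4^-1 <= hi -> pset p lo hi `<=` A ->
  pset p (lo + 4^-1) (hi + 3 / 4) `<=` halo F lam A.
Proof.
move=> FT lh pA _ [a aI <-]; exists (reflect T) => //; rewrite mu_reflect; apply: lt_le_trans small _.
pose w : V := \row_i (Num.min hi (a ord0 i) - 4^-1).
have q4 : 0 < 4^-1 :> R by rewrite invr_gt0.
rewrite -(mu_translate (p + w *m X)); apply: le_mu => z /translateP[u uI].
rewrite add0r => zE.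
have {}zE : z = p + (w + u) *m X by rewrite mulmxDl addrA zE addrC subrK.
have wI i : lo <= w ord0 i /\ w ord0 i <= a ord0 i - 4^-1 /\ w ord0 i <= hi - 4^-1 /\
    a ord0 i - 1 <= w ord0 i.
  have /andP[? ?] := aI i; rewrite mxE; have [?|?] := leP hi (a ord0 i);
    by split; [|split; [|split]]; lra.
split; last first.
  apply: pA; exists (w + u) => // i; have [? [? [? ?]]] := wI i; have /andP[? ?] := uI i.
  by rewrite mxE; apply/andP; split; lra.
apply/translateP/reflectP; rewrite zE opprB opprD addrACA subrr add0r -mulmxBl; apply: T01 => i.
have [? [? [? ?]]] := wI i; have /andP[? ?] := uI i.
by rewrite mxE [(- (w + u)) _ _]mxE [(w + u) _ _]mxE; apply/andP; split; lra.
Qed.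

End steps.
End parallelepipeds.

(** * Iterated halos and the cell where the mass concentrates *)

Section covering.
Context {R : realType} {n : nat}.
Local Notation V := 'rV[R]_n.
Local Notation Rn := (measurable_rV R n).
Local Notation mu := (@lebesgue_rV R n).

Definition double_halo (F : set (set V)) (lam : R) (A : set V) : set V :=
  halo (reflect @` F) lam (halo F lam A).

Lemma pset_double_halo (X : 'M[R]_n) (T : set Rn) (lam : R) (F : set (set V)) p lo hi A :
  (forall a : V, (forall i, 0 <= a ord0 i <= 1) -> T (a *m X)) ->
  (lam%:E * mu T < mu (pset X 0 0 4^-1))%E -> F T ->
  lo + 4^-1 <= hi -> pset X p lo hi `<=` A ->
  forall k, pset X p (lo - k%:R / 2) (hi + k%:R / 2) `<=` iter k (double_halo F lam) A.
Proof.
move=> T01 small FT lh pA; elim=> [|k IH]; first by rewrite !mul0r subr0 addr0.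
have k0 : 0 <= k%:R :> R by rewrite ler0n.
have lhk : lo - k%:R / 2 + 4^-1 <= hi + k%:R / 2 by lra.
have step1 := halo_step_forward T01 small FT lhk IH.
have lhk' : lo - k%:R / 2 - 3 / 4 + 4^-1 <= hi + k%:R / 2 - 4^-1 by lra.
have step2 := halo_step_backward T01 small (ex_intro2 _ _ _ FT erefl : (reflect @` F) (reflect T)) lhk' step1.
rewrite iterS; move: step2; rewrite -[k.+1%:R]natr1.
have -> : lo - k%:R / 2 - 3 / 4 + 4^-1 = lo - (k%:R + 1) / 2 by lra.
by have -> : hi + k%:R / 2 - 4^-1 + 3 / 4 = hi + (k%:R + 1) / 2 by lra.
Qed.

Lemma reflectK : involutive (@reflect R n).
Proof. by move=> S; apply/seteqP; split => x; rewrite !reflectP opprK. Qed.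

(** The bound for the reflected family follows from that for F by [reflect_halo], since [mu] is
    invariant under reflection; each round costs C^2. *)
Lemma mu_iter_double_halo (F : set (set V)) (lam C : R) (A : set V) :
  0 < C -> (forall T, F T -> measurable (T : set Rn)) ->
  (forall O : set V, open O -> mu (halo F lam O) <= C%:E * mu O)%E -> open A ->
  forall k, open (iter k (double_halo F lam) A) /\
    (mu (iter k (double_halo F lam) A) <= ((C ^+ 2) ^+ k)%:E * mu A)%E.
Proof.
move=> C0 mF FC oA; elim=> [|k [oI muI]]; first by rewrite expr0 mul1e.
have oH : open (halo F lam (iter k (double_halo F lam) A)) by exact: open_halo.
have muH (O : set V) : open O -> (mu (halo (reflect @` F) lam O) <= C%:E * mu O)%E.
  move=> oO; rewrite -[in leLHS](reflectK O) -reflect_halo mu_reflect -(mu_reflect O).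
  by apply: FC; exact: open_reflect.
rewrite iterS; split.
  by apply: open_halo => // _ [T FT <-]; apply/measurable_reflect/mF.
apply: le_trans (muH _ oH) _.
have -> : (C ^+ 2) ^+ k.+1 = C * (C * (C ^+ 2) ^+ k) by rewrite exprS expr2 mulrA.
rewrite EFinM -muleA lee_pmul2l//; apply: le_trans (FC _ oI) _.
by rewrite EFinM -muleA lee_pmul2l.
Qed.

(* Pigeonhole over the cells of side 1/2 of the parallelepiped v + X[-2n,2n]^n; the
   translates z + T considered contain the selected cell. *)
Lemma concentrate_on_pset (X : 'M[R]_n) (T : set Rn) (f : Rn -> R) (v : V) (c : R) :
  X \in unitmx -> measurable T -> (mu T < +oo)%E ->
  (forall a : V, (forall i, 0 <= a ord0 i <= 1) -> T (a *m X)) ->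
  T `<=` pset X 0 (- (2 * n%:R)) (2 * n%:R) ->
  lebesgue_integrable f ->
  (c%:E * mu T < \int[mu]_(y in translate v T) `|f y|%:E)%E ->
  exists p, translate v T `<=` pset X p (- (4 * n%:R)) (4 * n%:R) /\
    forall z, pset X p (- 2^-1) 0 z ->
    ((c / ((8 * n).+1 ^ n)%:R)%:E * mu T < \int[mu]_(y in translate z T) `|f y|%:E)%E.
Proof.
move=> Xu mT Too T01 Tm intf cT.
pose m : R := 2 * n%:R.
have mE : m = 2 * n%:R by [].
(* Each axis of [-m,m] has 8n intervals of length 1/2. The index comes from a truncation, so the
   endpoint m needs one more. *)
pose J := {ffun 'I_n -> 'I_(8 * n).+1}.
pose w (j : J) : V := \row_i ((j i)%:R / 2 - m).
pose q j := pset X (v + w j *m X) 0 2^-1.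
have mf : measurable_fun [set: Rn] (fun y => `|f y|%:E).
  apply/measurable_EFinP; apply: measurableT_comp => //.
  exact/measurable_EFinP/measurable_int/intf.
have mS : measurable (translate v T : set Rn) by exact: measurable_translate.
have mSq j : measurable (translate v T `&` q j : set Rn).
  by apply: measurableI => //; exact: measurable_pset.
have Sq : translate v T `<=` \big[setU/set0]_(j <- enum J) (translate v T `&` q j).
  move=> x Sx; rewrite -bigcup_seq.
  have /translateP/Tm[a aI] := Sx; rewrite add0r => aE.
  pose jn i := Num.truncn (2 * (a ord0 i + m)).
  have jP i : (jn i < (8 * n).+1)%N.
    rewrite ltnS -(ler_nat R) natrM; apply: le_trans (_ : 2 * (a ord0 i + m) <= _).
      rewrite truncn_le// mulr_ge0//; have /andP[? ?] := aI i; lra.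
    have /andP[? ?] := aI i; lra.
  exists [ffun i => Ordinal (jP i)]; first by rewrite /= mem_enum.
  split => //; exists (a - w [ffun i => Ordinal (jP i)]); last first.
    by rewrite mulmxBl addrACA subrr addr0 aE addrC subrK.
  move=> i; rewrite !mxE ffunE /=.
  have a0 : 0 <= 2 * (a ord0 i + m) by rewrite mulr_ge0//; have /andP[? ?] := aI i; lra.
  have := truncn_itv a0; rewrite -/(jn i) -[(jn i).+1%:R]natr1 => /andP[? ?].
  by apply/andP; split; lra.
have [j qj] : exists j, ((c / ((8 * n).+1 ^ n)%:R)%:E * mu T <
    \int[mu]_(y in translate v T `&` q j) `|f y|%:E)%E.
  apply: contrapT => noj; move: cT; apply/negP; rewrite -leNgt.
  have mU : measurable (\big[setU/set0]_(j <- enum J) (translate v T `&` q j) : set Rn).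
    by apply: bigsetU_measurable.
  have absf0 (y : Rn) : (0 <= `|f y|%:E)%E by rewrite lee_fin.
  apply: le_trans (ge0_subset_integral mu mS mU (measurable_funTS mf) (fun y _ => absf0 y) Sq) _.
  apply: le_trans (ge0_integral_bigsetU_le mu (enum J) mf absf0 mSq) _.
  apply: (@le_trans _ _ (\sum_(j <- enum J) (c / ((8 * n).+1 ^ n)%:R)%:E * mu T)%E).
    by apply: lee_sum => j _; rewrite leNgt; apply/negP => h; apply: noj; exists j.
  have Tfin : mu T \is a fin_num by rewrite ge0_fin_numE ?mu_ge0.
  rewrite -(fineK Tfin) -!EFinM sumEFin lee_fin big_enum sumr_const.
  rewrite card_ffun !card_ord -[(_ * _) *+ _]mulr_natl.
  have N0 : ((8 * n).+1 ^ n)%:R != 0 :> R by rewrite pnatr_eq0 expn_eq0.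
  by rewrite mulrA [_ * (c / _)]mulrC divfK.
(* This is the lower corner p of the selected cell. Relative to v, both p and T have coordinates in
   [-2n,2n], whence 4n. For z = p + bX with b in [-1/2,0]^n, z + T contains the cell because [0,1/2]
   - [-1/2,0] = [0,1]. *)
exists (v + w j *m X); split.
  move=> x /translateP/Tm[a aI]; rewrite add0r => aE.
  exists (a - w j); last by rewrite mulmxBl addrACA subrr addr0 aE addrC subrK.
  move=> i; have := ltn_ord (j i); rewrite ltnS -(ler_nat R) natrM => jn.
  have j0 : 0 <= (j i)%:R :> R by rewrite ler0n.
  by have /andP[? ?] := aI i; rewrite !mxE; apply/andP; split; lra.
move=> z [b bI bz]; apply: lt_le_trans qj _; apply: ge0_subset_integral => //.
- exact: measurable_translate.
- exact: measurable_funTS.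
- move=> x [_ [a aI ax]]; apply/translateP; rewrite -ax -bz opprD addrACA subrr add0r.
  rewrite -mulmxBl; apply: T01 => i; have /andP[? ?] := aI i; have /andP[? ?] := bI i.
  by rewrite !mxE; apply/andP; split; lra.
Qed.

End covering.

(** * Comparison of the two maximal functions *)

Section comparison.
Context {R : realType} {n : nat}.
Local Notation V := 'rV[R]_n.
Local Notation Rn := (measurable_rV R n).
Local Notation mu := (@lebesgue_rV R n).
Local Open Scope ereal_scope.
Implicit Types B : diff_basis R n.

Lemma busemann_feller_majorized B : (0 < n)%N ->
  translation_invariant B -> convex_basis B -> density_basis B ->
  exists c delta : R, [/\ (1 <= c)%R, (0 < delta)%R &
  forall f (r lambda : R), lebesgue_integrable f ->
    (0 < r < delta)%R -> (0 < lambda)%R ->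
    mu [set x | lambda%:E <= maximal (busemann_feller B) r%:E f x]
      <= c%:E * mu [set x | (lambda / c)%:E <= maximal B (c * r)%:E f x]].
Proof.
move=> n0 tB cB dB.
pose m : R := (2 * n%:R)%R.
have m0 : (0 < m)%R by rewrite mulr_gt0// ltr0n.
pose lam : R := (((8 * m) ^+ n)^-1 / 2)%R.
have lam0 : (0 < lam)%R by rewrite divr_gt0// invr_gt0 exprn_gt0// mulr_gt0.
have [C [d [C0 d0 CB]]] := density_halo tB dB lam0.
pose N : R := ((8 * n).+1 ^ n)%:R.
have N0 : (0 < N)%R by rewrite ltr0n expn_gt0.
pose K : R := ((C ^+ 2) ^+ (8 * n))%R.
have K0 : (0 < K)%R by rewrite !exprn_gt0.
(* One constant for three purposes: K bounds the measure, 2N the loss of level (N cells, and 2 for a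
   strict inequality), and 1 ensures that the radius does not shrink. *)
pose c : R := (1 + 2 * N + K)%R.
have c0 : (0 < c)%R by rewrite !addr_gt0// mulr_gt0.
have c1 : (1 <= c)%R by rewrite /c -addrA lerDl addr_ge0// ltW// mulr_gt0.
exists c, d; split => //.
move=> f r lambda intf /andP[r0 rd] l0.
pose absf (y : Rn) : R := `|f y|%R.
have intabsf : lebesgue_integrable absf by exact: integrable_norm.
pose A : set V := [set x | exists2 S, basis_lt B x r%:E S & (lambda / 2 / N)%:E < average absf S].
have oA : open A by exact: open_lt_sup_average.
pose F : set (set V) := basis_lt B 0%R r%:E.
have mF T : F T -> measurable (T : set Rn) by exact: basis_lt_measurable.
have FC (O : set V) : open O -> mu (halo F lam O) <= C%:E * mu O.
  move=> oO; apply: le_trans (CB _ oO); apply: le_mu; apply: halo_subset => //.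
  by apply: basis_lt_subset; rewrite lee_fin ltW.
have [_ muI] := mu_iter_double_halo C0 mF FC oA (8 * n)%N.
apply: (@le_trans _ _ (K%:E * mu A)).
  apply: le_trans muI; apply: le_mu => x /= lx.
  have l2 : (lambda / 2)%:E < maximal (busemann_feller B) r%:E f x.
    by apply: lt_le_trans lx; rewrite lte_fin ltr_pdivrMr// ltr_pMr// ltr1n.
  have [_ [S [[[y _ ByS] Sx] Sr] <-] lS] := ereal_sup_gt l2.
  have /(basis_lt_translate _ _ _ tB)[T FT ST] : basis_lt B y r%:E S by [].
  have [BT Tr] := FT; have [bT mT T0 T00] := basis_atP BT.
  have Too := basis_mu_lty BT.
  have [X [Xu T01 TX]] := convex_sandwich n0 mT bT (cB _ _ BT) T00 T0.
  have Tm : T `<=` pset X 0 (- m)%R m.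
    move=> z /TX[a -> am]; exists a; last by rewrite add0r.
    by move=> i; rewrite -ler_norml; exact: am.
  have small := mu_lt_pset m0 T01 Tm T0 Too.
  rewrite lt_average ?ST ?mu_translate// in lS.
  have [p [Sp pA]] := concentrate_on_pset Xu mT Too T01 Tm intf lS.
  have pA' : pset X p (- 2^-1)%R 0 `<=` A.
    move=> z /pA zT; exists (translate z T).
      by apply/(basis_lt_translate _ _ _ tB); exists T.
    by rewrite lt_average ?mu_translate.
  have h4 : (- 2^-1 + 4^-1 <= 0 :> R)%R by lra.
  (* The 8n rounds turn [-1/2,0] into [-1/2-4n,4n], which contains the interval [-4n,4n] of [Sp]. *)
  apply: (pset_double_halo T01 small FT h4 pA').
  have [a aI <-] : pset X p (- (4 * n%:R))%R (4 * n%:R)%R x by apply: Sp; rewrite -ST.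
  exists a => // i; have /andP[? ?] := aI i; rewrite natrM.
  by apply/andP; split; lra.
apply: (@le_trans _ _ (c%:E * mu A)).
  apply: lee_wpmul2r; first exact: mu_ge0.
  by rewrite lee_fin /c lerDr addr_ge0// mulr_ge0// ltW.
rewrite lee_pmul2l//; apply: le_mu => x [S [BS Sr] lS] /=.
apply: le_trans (_ : average absf S <= _).
  apply: le_trans (ltW lS); rewrite lee_fin -mulrA ler_pM2l//.
  rewrite -invfM lef_pV2 ?posrE ?mulr_gt0// /c.
  by rewrite addrAC lerDr addr_ge0// ltW.
apply: ereal_sup_ubound; exists S => //; split => //.
apply: lt_le_trans Sr _; rewrite lee_fin; apply: ler_peMl => //; exact: ltW.
Qed.

Lemma mu_negligible (Z : set V) : mu Z = 0 -> mu.-negligible (Z : set Rn).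
Proof.
move=> Z0; exists Z; split => //.
apply: (@le_caratheodory_measurable R V (@lebesgue_outer R n)) => X.
rewrite [X in X + _](_ : _ = 0) ?add0e.
  by apply: le_mu => x [].
by apply/eqP; rewrite eq_le mu_ge0 andbT -Z0; apply: le_mu => x [].
Qed.

(** That the upper derivative is at most a and the lower one at least a is direct; the opposite
    inequalities need a set at every scale, supplied by [basis_at_shrink]. *)
Lemma derivatives_eq B (f : Rn -> R) x (a : R) :
  (forall lam : R, (0 < lam)%R -> exists2 e : R, (0 < e)%R &
    forall S, basis_lt B x e%:E S -> (a - lam)%:E <= average f S <= (a + lam)%:E) ->
  upper_derivative B f x = a%:E /\ lower_derivative B f x = a%:E.
Proof.
move=> near_a.
have nonempty (e : R) : (0 < e)%R -> exists S, basis_lt B x e%:E S.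
  move=> e0; have [S_ BS /(_ [set y | y < e%:E])] := basis_at_shrink B x.
  case; first by apply: open_ereal_lt'; rewrite lte_fin.
  by move=> k _ /(_ k (leqnn _)) /= Sk; exists (S_ k).
have common (e lam : R) : (0 < e)%R -> (0 < lam)%R -> exists2 S,
    basis_lt B x e%:E S & (a - lam)%:E <= average f S <= (a + lam)%:E.
  move=> e0 /near_a[e' e'0 aS].
  have [|S eS] := nonempty (Num.min e e'); first by rewrite lt_min e0.
  exists S; first by apply: basis_lt_subset eS; rewrite lee_fin ge_min lexx.
  by apply: aS; apply: basis_lt_subset eS; rewrite lee_fin ge_min lexx orbT.
split; apply/eqP; rewrite eq_le; apply/andP; split.
- apply/lee_addgt0Pr => lam lam0; have [e e0 aS] := near_a _ lam0.
  apply: (@le_trans _ _ (ereal_sup [set average f S | S in basis_lt B x e%:E])).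
    by apply: ereal_inf_lbound; exists e.
  by apply: ub_ereal_sup => _ [S /aS/andP[_ ?] <-].
- apply: le_ereal_inf_tmp => _ [e e0 <-]; apply/lee_subgt0Pr => lam lam0.
  have [S eS /andP[aS _]] := common _ _ e0 lam0.
  by apply: le_trans aS _; apply: ereal_sup_ubound; exists S.
- apply: ub_ereal_sup => _ [e e0 <-]; apply/lee_addgt0Pr => lam lam0.
  have [S eS /andP[_ aS]] := common _ _ e0 lam0.
  by apply: le_trans aS; apply: ereal_inf_lbound; exists S.
- apply/lee_subgt0Pr => lam lam0; have [e e0 aS] := near_a _ lam0.
  apply: le_trans (_ : ereal_inf [set average f S | S in basis_lt B x e%:E] <= _).
    by apply: le_ereal_inf_tmp => _ [S /aS/andP[? _] <-].
  by apply: ereal_sup_ubound; exists e.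
Qed.

End comparison.

(** * From the weak type inequality to the density property *)

Section density.
Context {R : realType} {n : nat}.
Local Notation V := 'rV[R]_n.
Local Notation Rn := (measurable_rV R n).
Local Notation mu := (@lebesgue_rV R n).
Local Open Scope ereal_scope.
Implicit Types B : diff_basis R n.

Definition dispersed B (E : set V) (x : V) := forall lam : R, (0 < lam)%R ->
  exists2 e : R, (0 < e)%R & forall S, basis_lt B x e%:E S ->
    mu (S `&` E) <= lam%:E * mu S.

(** Near a point of Q outside E, small sets S lie in an open U slightly larger than Q minus E, so
    they meet E only inside an open W of small measure; the weak type inequality for W bounds the
    exceptional set by eta. *)
Lemma ae_dispersed B (E : set Rn) :
  (forall lam : R, (0 < lam)%R -> exists C r : R, [/\ (0 < C)%R, (0 < r)%R &
    forall O : set V, open O -> mu O < +oo ->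
      mu [set x | exists2 S, basis_lt B x r%:E S & lam%:E * mu S < mu (S `&` O)]
        <= C%:E * mu O]) ->
  measurable E -> bounded_set (E : set V) ->
  {ae mu, forall x, ~ E x -> dispersed B E x}.
Proof.
move=> weakB mE bE; have [M M0 EM] := bounded_cube bE.
pose l k : R := (k.+1%:R^-1)%R.
have l0 k : (0 < l k)%R by rewrite invr_gt0.
pose Z k := [set x : V | ~ E x /\ forall e : R, (0 < e)%R ->
  exists2 S, basis_lt B x e%:E S & (l k)%:E * mu S < mu (S `&` E)].
suff Z0 k : mu (Z k) = 0.
  have : mu.-negligible (\bigcup_k (Z k : set Rn)).
    by apply: negligible_bigcup => k; exact: mu_negligible.
  apply: negligibleS => x /= /not_implyP[nEx /existsNP[lam /not_implyP[lam0 ndisp]]].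
  have [k] := @ltr_add_invr R 0 lam lam0; rewrite add0r => klam.
  exists k => //; split => // e e0; apply: contrapT => noS; apply: ndisp.
  exists e => // S eS; rewrite leNgt; apply/negP => lS; apply: noS; exists S => //.
  apply: le_lt_trans lS; apply: lee_wpmul2r; first exact: mu_ge0.
  by rewrite lee_fin ltW.
apply/eqP; rewrite eq_le mu_ge0 andbT; apply/lee_addgt0Pr => eta eta0.
rewrite add0e.
have [C [r [C0 r0 CP]]] := weakB _ (l0 k).
(* Then mu W <= 2 eps = eta / C. *)
pose eps : R := (eta / (2 * C))%R.
have eps0 : (0 < eps)%R by rewrite divr_gt0// mulr_gt0.
pose Q : set V := cube 0 (M + 1)%R.
have mQ : measurable (Q : set Rn) by exact/open_measurable_rV/open_cube.
have mQE : measurable (Q `\` E : set Rn) by exact: measurableD.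
have QEoo : mu (Q `\` E) < +oo.
  by apply: le_lt_trans (mu_cube_lty 0 (M + 1)%R); apply: le_mu => x [].
have [U [oU QEU Ueps]] := outer_regular QEoo eps0.
have mU := open_measurable_rV oU.
have UE : mu (U `&` E) <= eps%:E.
  have Usplit : mu U = mu (U `\` E) + mu (U `&` E) by exact: (measureDI mu mU mE).
  have : mu (Q `\` E) + mu (U `&` E) <= mu (Q `\` E) + eps%:E.
    apply: le_trans Ueps; rewrite Usplit; apply: leeD2r; apply: le_mu => x QEx.
    by split; [exact: QEU|case: QEx].
  by rewrite leeD2lE// ge0_fin_numE ?mu_ge0.
have UEoo : mu (U `&` E) < +oo by apply: le_lt_trans UE _; exact: ltry.
have [W [oW UEW Weps]] := outer_regular UEoo eps0.
have Wle : mu W <= (eta / C)%:E.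
  apply: le_trans Weps _; apply: le_trans (leeD2r _ UE) _.
  rewrite -EFinD lee_fin /eps le_eqVlt; apply/orP; left; apply/eqP.
  by field; rewrite gt_eqF.
have Woo : mu W < +oo by apply: le_lt_trans Wle _; exact: ltry.
apply: (@le_trans _ _ (C%:E * mu W)); last first.
  apply: (@le_trans _ _ (C%:E * (eta / C)%:E)); first by rewrite lee_pmul2l.
  by rewrite -EFinM mulrC divfK// gt_eqF.
apply: le_trans (CP W oW Woo); apply: le_mu => x [nEx xS].
have [Qx|nQx] := pselect (Q x).
  have /rV_openP/(_ x (QEU _ (conj Qx nEx)))[e e0 xU] := oU.
  have [|S [BS Sre] lS] := xS (Num.min r e); first by rewrite lt_min r0.
  exists S; first by split => //; apply: lt_le_trans Sre _; rewrite lee_fin ge_min lexx.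
  apply: lt_le_trans lS _; apply: le_mu => y [Sy Ey]; split => //; apply: UEW; split => //.
  have [_ _ _ Sx] := basis_atP BS.
  apply: xU; apply: diam_lt_cube Sx Sy; apply: lt_le_trans Sre _.
  by rewrite lee_fin ge_min lexx orbT.
have [S [BS S1] lS] := xS 1%R ltr01.
exfalso; apply: nQx.
have [[y [Sy Ey]]|noy] := pselect (exists y, S y /\ E y).
  have [_ _ _ Sx] := basis_atP BS.
  exact: cube_trans (EM _ Ey) (diam_lt_cube S1 Sy Sx).
move: lS; rewrite (_ : S `&` E = set0); last first.
  by apply/seteqP; split => // y SEy; apply: noy; exists y.
have -> : mu set0 = 0 by exact: lebesgue_outer0.
by rewrite ltNge mule_ge0// ?mu_ge0// lee_fin ltW.
Qed.

(** [ae_dispersed] for E settles the points outside E; for the points of E it is applied to Q minus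
    E. The extra unit in Q keeps sets of diameter below 1 around a point of E inside Q. *)
Lemma weak_type_density B :
  (forall lam : R, (0 < lam)%R -> exists C r : R, [/\ (0 < C)%R, (0 < r)%R &
    forall O : set V, open O -> mu O < +oo ->
      mu [set x | exists2 S, basis_lt B x r%:E S & lam%:E * mu S < mu (S `&` O)]
        <= C%:E * mu O]) ->
  density_basis B.
Proof.
move=> weakB E mE bE; have [M M0 EM] := bounded_cube bE.
pose Q : set V := cube 0 (M + 1)%R.
have mQ : measurable (Q : set Rn) by exact/open_measurable_rV/open_cube.
have mQE : measurable (Q `\` E : set Rn) by exact: measurableD.
have bQE : bounded_set (Q `\` E).
  by apply: (@cube_bounded _ _ _ (M + 1)%R) => x [].
have aeE := ae_dispersed weakB mE bE; have aeQE := ae_dispersed weakB mQE bQE.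
apply: filterS2 aeE aeQE => x Ex QEx; apply: derivatives_eq => lam lam0.
have avg_le1 S : B x S -> average \1_E S <= 1.
  move=> BS; have [_ mS S0 _] := basis_atP BS; have Soo := basis_mu_lty BS.
  by rewrite leNgt average_indic_gt// mul1e -leNgt; apply: le_mu => y [].
have avg_ge0 S : B x S -> 0 <= average \1_E S.
  move=> BS; have [_ mS S0 _] := basis_atP BS; have Soo := basis_mu_lty BS.
  by rewrite leNgt average_indic_lt// mul0e -leNgt mu_ge0.
have [xE|nxE] := pselect (E x); last first.
  have [e e0 eS] := Ex nxE _ lam0; exists e => // S [BS Se].
  have [_ mS S0 _] := basis_atP BS; have Soo := basis_mu_lty BS.
  rewrite indicE memNset// sub0r add0r; apply/andP; split.
    by apply: le_trans (avg_ge0 S BS); rewrite lee_fin oppr_le0 ltW.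
  by rewrite leNgt average_indic_gt// -leNgt; exact: eS.
have [|e e0 eS] := QEx _ _ lam0; first by case.
exists (Num.min 1%R e); first by rewrite lt_min ltr01.
move=> S [BS Se]; have [_ mS S0 Sx] := basis_atP BS; have Soo := basis_mu_lty BS.
rewrite indicE mem_set//; apply/andP; split; last first.
  by apply: le_trans (avg_le1 S BS) _; rewrite lee_fin lerDl ltW.
rewrite leNgt average_indic_lt// -leNgt.
have SQ : S `<=` Q.
  move=> y Sy; apply: cube_trans (EM _ xE) _; apply: diam_lt_cube Sx Sy.
  by apply: lt_le_trans Se _; rewrite lee_fin ge_min lexx.
have Sfin : mu S \is a fin_num by rewrite ge0_fin_numE ?mu_ge0.
have Ssplit : mu S = mu (S `\` E) + mu (S `&` E) by exact: (measureDI mu mS mE).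
have SE : mu (S `\` E) <= lam%:E * mu S.
  apply: le_trans (eS S _); last first.
    by split => //; apply: lt_le_trans Se _; rewrite lee_fin ge_min lexx orbT.
  by apply: le_mu => y [Sy nEy]; split => //; split => //; exact: SQ.
have afin : mu (S `\` E) \is a fin_num.
  by rewrite ge0_fin_numE ?mu_ge0// (le_lt_trans _ Soo)//; apply: le_mu => y [].
have bfin : mu (S `&` E) \is a fin_num.
  by rewrite ge0_fin_numE ?mu_ge0// (le_lt_trans _ Soo)//; apply: le_mu => y [].
move: Ssplit SE; rewrite -(fineK Sfin) -(fineK afin) -(fineK bfin) -EFinD -!EFinM => -[sE].
by rewrite !lee_fin mulrBl mul1r; lra.
Qed.

Lemma busemann_feller_density B : (0 < n)%N ->
  translation_invariant B -> convex_basis B -> density_basis B ->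
  density_basis (busemann_feller B).
Proof.
move=> n0 tB cB dB; apply: weak_type_density => lam lam0.
have [c [delta [c1 delta0 majB]]] := busemann_feller_majorized n0 tB cB dB.
have c0 : (0 < c)%R by exact: lt_le_trans c1.
have lc0 : (0 < lam / c / 2)%R by rewrite !divr_gt0.
have [C [d [C0 d0 CB]]] := density_halo tB dB lc0.
(* The majorization asks for r < delta, the weak type inequality of B for c r <= d. *)
pose r : R := Num.min (delta / 2)%R (d / c)%R.
have r0 : (0 < r)%R by rewrite lt_min !divr_gt0.
exists (c * C)%R, r; split => //; first exact: mulr_gt0.
move=> O oO Ooo; have mO := open_measurable_rV oO.
(* The finiteness of [mu O] enters here: the majorization is stated for integrable functions. *)
have intO : lebesgue_integrable (\1_(O : set Rn)).
  apply/integrableP; split; first by apply/measurable_EFinP; exact: measurable_indic.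
  rewrite (eq_integral (fun y => (\1_(O : set Rn) y)%:E)); last first.
    by move=> y _; rewrite /= indicE ger0_norm.
  by rewrite integral_indic// setIT.
have rdelta : (0 < r < delta)%R.
  by rewrite r0 gt_min ltr_pdivrMr// ltr_pMr// ltr1n.
have abs1 : (fun y : Rn => `|\1_(O : set Rn) y|%R) = \1_(O : set Rn) :> (Rn -> R).
  by apply/funext => y; rewrite indicE ger0_norm.
apply: (@le_trans _ _ (c%:E * mu [set x | (lam / c)%:E <= maximal B (c * r)%:E \1_(O : set Rn) x])).
  apply: le_trans (majB _ _ _ intO rdelta lam0); apply: le_mu => x [S [BS Sr] lS] /=.
  have [_ mS S0 _] := basis_atP BS; have Soo := basis_mu_lty BS.
  apply: (@le_trans _ _ (average \1_(O : set Rn) S)).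
    by apply/ltW; rewrite average_indic_gt.
  by rewrite /maximal abs1; apply: ereal_sup_ubound; exists S.
rewrite [(c * C)%:E]EFinM -muleA lee_pmul2l//; apply: le_trans (CB _ oO); apply: le_mu => x /= lx.
have : (lam / c / 2)%:E < maximal B (c * r)%:E \1_(O : set Rn) x.
  by apply: lt_le_trans lx; rewrite lte_fin ltr_pdivrMr// ltr_pMr ?divr_gt0// ltr1n.
rewrite /maximal abs1 => /ereal_sup_gt[_ [S BS <-] lS].
have [T [BT Tr] ST] := (basis_lt_translate _ _ _ tB).1 BS.
exists T.
  split => //; apply: lt_le_trans Tr _; rewrite lee_fin.
  by rewrite mulrC -ler_pdivlMr// ge_min lexx orbT.
have [_ mS S0 _] := basis_atP BS.1; have Soo := basis_mu_lty BS.1.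
by move: lS; rewrite average_indic_gt// ST mu_translate.
Qed.

End density.

Theorem theorem3 (R : realType) (n : nat) (n_ge2 : (2 <= n)%N)
    (B : diff_basis R n) :
  translation_invariant B -> convex_basis B -> density_basis B ->
  density_basis (busemann_feller B) /\
  locally_majorized B (busemann_feller B) /\
  locally_majorized (busemann_feller B) B.
Proof.
move=> tB cB dB; have n0 : (0 < n)%N by exact: leq_trans n_ge2.
have mB := translation_invariant_measurable tB.
have mBF := translation_invariant_measurable (busemann_feller_translation_invariant tB).
split; first exact: busemann_feller_density.
split; split => //; last exact: busemann_feller_majorized.
(* Each set of B at x contains x, hence belongs to the extension at x: the maximal functions are
   ordered pointwise. *)
exists 1, 1; split => // f r lambda _ _ _; rewrite mul1e mul1r divr1.
apply: le_mu => x /= /le_trans; apply; apply: le_ereal_sup => _ [S [BS Sr] <-].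
exists S => //; split => //; split; first by exists x.
by have [] := basis_atP BS.
Qed.
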